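(* Let $\Omega_0,\Omega_1$ be Polish spaces with Borel $\sigma$-algebras $\Sigma_0,\Sigma_1$, let $\mathcal E\subseteq\Omega_0\times\Omega_1$ be closed with all neighborhoods $N_1(x)$ ($x\in\Omega_0$) and $N_0(y)$ ($y\in\Omega_1$) nonempty, and let $\nu_0,\nu_1$ be finite nonzero measures on $\Omega_0,\Omega_1$. Let $\mathfrak E_{\mathcal E}$ be the induced continuum economy. (1) Let $(\pi_0,\pi_1)\in\Pi^{\mathcal E}_0\times\Pi^{\mathcal E}_1$ be such that $\pi_0$ is level-optimal maximin from side $0$ to side $1$ and $\pi_1$ is level-optimal maximin from side $1$ to side $0$. Then any allocation--price pair $(a,p)$ induced by $(\pi_0,\pi_1)$ (in the sense of the construction given in the context) is a Walrasian equilibrium of $\mathfrak E_{\mathcal E}$. (2) Conversely, if $(a,p)$ is a Walrasian equilibrium of $\mathfrak E_{\mathcal E}$, then any pair $(\pi_0,\pi_1)\in\Pi^{\mathcal E}_0\times\Pi^{\mathcal E}_1$ extracted from $a$ (in the sense of the construction given in the context) is such that $\pi_0$ is level-optimal maximin from side $0$ to side $1$ and $\pi_1$ is level-optimal maximin from side $1$ to side $0$.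
   Context: Notation. $\bar\iota=1-\iota$ for $\iota\in\{0,1\}$. $\mathcal M_+(\Omega)$ is the set of finite nonnegative measures; $T_\#$ is pushforward; $\mathrm{pr}_\iota:\Omega_0\times\Omega_1\to\Omega_\iota$ the projection. $N_1(x)=\{y\in\Omega_1:(x,y)\in\mathcal E\}$, $N_0(y)=\{x\in\Omega_0:(x,y)\in\mathcal E\}$, $N_{\bar\iota}(S)=\bigcup_{s\in S}N_{\bar\iota}(s)$ for $S\subseteq\Omega_\iota$. For a measure $\eta$ on $\Omega_\iota$ and a kernel $K$ from $\Omega_\iota$ to $\Omega_{\bar\iota}$, $\eta\bowtie K$ is the measure on $\Omega_0\times\Omega_1$ giving mass $\int_A K(x,B)\,\eta(dx)$ to the set of pairs with $\iota$-coordinate in $A$ and $\bar\iota$-coordinate in $B$. Refinements. $\Pi^{\mathcal E}_\iota=\{\pi\in\mathcal M_+(\Omega_0\times\Omega_1):\pi(\mathcal E^c)=0,\ (\mathrm{pr}_\iota)_\#\pi=\nu_\iota\}$. Level-optimal maximin. For $\pi\in\Pi^{\mathcal E}_\iota$ let $P=(\mathrm{pr}_{\bar\iota})_\#\pi=r\,\nu_{\bar\iota}+P^\perp$ be the Lebesgue decomposition with respect to $\nu_{\bar\iota}$. For $t\ge0$, $\mathsf{Feas}_{\bar\iota}(t)$ is the set of $\sigma\in\mathcal M_+(\Omega_0\times\Omega_1)$ with $\sigma(\mathcal E^c)=0$, $(\mathrm{pr}_\iota)_\#\sigma\le\nu_\iota$, $(\mathrm{pr}_{\bar\iota})_\#\sigma\le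 t\,\nu_{\bar\iota}$, and $\mathsf{Fit}_{\bar\iota}(t)=\sup\{\sigma(\Omega_0\times\Omega_1):\sigma\in\mathsf{Feas}_{\bar\iota}(t)\}$. $\pi$ is level-optimal maximin from side $\iota$ to side $\bar\iota$ if $\int(r\wedge t)\,d\nu_{\bar\iota}=\mathsf{Fit}_{\bar\iota}(t)$ for every $t>0$. Induced continuum economy $\mathfrak E_{\mathcal E}$. Agents: $T=\Omega_0\sqcup\Omega_1$ with the disjoint-union $\sigma$-algebra $\Sigma$ and measure $\mu=\nu_0\oplus\nu_1$. Commodity bundles are measures $z=z_0\oplus z_1\in\mathcal M_+(T)$ with $z_\iota\in\mathcal M_+(\Omega_\iota)$. Prices are functions in $B_b(T)$ (bounded measurable real functions on $T$), with $\langle p,z\rangle=\int_T p\,dz$. Consumption sets: for $x\in\Omega_0$, $X(x)=\{z\in\mathcal M_+(T):z(\Omega_0\setminus\{x\})=0,\ z(\Omega_1\setminus N_1(x))=0\}$; for $y\in\Omega_1$, $X(y)=\{z\in\mathcal M_+(T):z(\Omega_1\setminus\{y\})=0,\ z(\Omega_0\setminus N_0(y))=0\}$. Endowments: $e(t)=\delta_t$. Utilities: $u_x(z)=z_1(N_1(x))$ for $x\in\Omega_0$, $u_y(z)=z_0(N_0(y))$ for $y\in\Omega_1$; agent $t$ strictly prefers $z$ to $z'$ in $X(t)$ iff $u_t(z)>u_t(z')$. An allocation is a map $a:T\to\mathcal M_+(T)$ with $a(t)\in X(t)$ for $\mu$-a.e. $t$, such that $t\mapsto\langle q,a(t)\rangle$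 is $\mu$-measurable and $\mu$-integrable for every $q\in B_b(T)$, and such that there is a finite signed measure $\int_T a\,d\mu$ on $T$ with $\langle q,\int_T a\,d\mu\rangle=\int_T\langle q,a(t)\rangle\,\mu(dt)$ for all $q\in B_b(T)$. It is feasible if $\int_T a\,d\mu=\int_T e\,d\mu=\mu$, i.e. $\int_T a(t)(B)\,\mu(dt)=\mu(B)$ for all $B\in\Sigma$. Budget set: $\mathcal B(t,p)=\{z\in X(t):\langle p,z\rangle\le\langle p,\delta_t\rangle=p(t)\}$. A Walrasian equilibrium is a pair $(a,p)$ with $p\in B_b(T)$, $p\ge0$, $p\not\equiv0$ (as a function), $a$ a feasible allocation, and, for $\mu$-a.e. $t$, $a(t)\in\mathcal B(t,p)$ and no $z\in\mathcal B(t,p)$ has $u_t(z)>u_t(a(t))$. Symmetric density decomposition of a pair $(\pi_0,\pi_1)$ as in (1). Let $P_\iota=(\mathrm{pr}_\iota)_\#\pi_{\bar\iota}$, with Lebesgue decomposition $P_\iota=P_\iota^{\mathrm{ac}}+P_\iota^\perp$ with respect to $\nu_\iota$; let $\nu_\iota=\nu_\iota^{\mathrm{ac}}+\nu_\iota^\perp$ be the Lebesgue decomposition of $\nu_\iota$ with respect to $P_\iota^{\mathrm{ac}}$; and let $\rho_\iota^{\mathrm{ac}}=dP_\iota^{\mathrm{ac}}/d\nu_\iota:\Omega_\iota\to[0,\infty)$ (a fixed version). Allocation--price pair induced by $(\pi_0,\pi_1)$. Choose, for $\iota\in\{0,1\}$, disjoint measurable sets $S_\iota^{\mathrm{ac}},S_\iota^\perp\in\Sigma_\iota$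 with $\nu_\iota^{\mathrm{ac}}(\Omega_\iota\setminus S_\iota^{\mathrm{ac}})=0$, $\nu_\iota^\perp(\Omega_\iota\setminus S_\iota^\perp)=0$, and measurable $\nu_{\bar\iota}$-null sets $M_{\bar\iota}\in\Sigma_{\bar\iota}$ with $\bigcup_{x\in S_\iota^{\mathrm{ac}}}\{y\in N_{\bar\iota}(x):\rho_\iota^{\mathrm{ac}}(x)\rho_{\bar\iota}^{\mathrm{ac}}(y)<1\}\subseteq M_{\bar\iota}$ and $N_{\bar\iota}(S_\iota^\perp)\subseteq M_{\bar\iota}$ (such sets exist). Take disintegrations $\pi_0=\nu_0\bowtie G_0$, $\pi_1=\nu_1\bowtie G_1$; set $\pi_0^{\mathrm{ac}}=\nu_0^{\mathrm{ac}}\bowtie G_0$, $\pi_1^{\mathrm{ac}}=\nu_1^{\mathrm{ac}}\bowtie G_1$; and take finite kernels $K_0$ from $\Omega_1$ to $\Omega_0$ and $K_1$ from $\Omega_0$ to $\Omega_1$ with $\pi_0^{\mathrm{ac}}=\nu_1^{\mathrm{ac}}\bowtie K_0$, $\pi_1^{\mathrm{ac}}=\nu_0^{\mathrm{ac}}\bowtie K_1$ (such kernels exist). Define $a(x)=0\oplus K_1(x,\cdot)$ for $x\in S_0^{\mathrm{ac}}$, $a(x)=\delta_x\oplus0$ for $x\in S_0^\perp$, $a(y)=K_0(y,\cdot)\oplus0$ for $y\in S_1^{\mathrm{ac}}$, $a(y)=0\oplus\delta_y$ for $y\in S_1^\perp$, and $a(t)=\delta_t$ at all remaining points. Define $p(t)=2$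 if $t\in M_0\cup M_1$ or $t\notin S_0^{\mathrm{ac}}\cup S_0^\perp\cup S_1^{\mathrm{ac}}\cup S_1^\perp$; otherwise $p(t)=\rho_\iota^{\mathrm{ac}}(t)/(1+\rho_\iota^{\mathrm{ac}}(t))$ for $t\in S_\iota^{\mathrm{ac}}$ and $p(t)=0$ for $t\in S_\iota^\perp$. Pair extracted from a feasible allocation $a$. Write $a(t)=a_0(t)\oplus a_1(t)$. Choose measurable probability kernels $G_0^{\mathrm{fb}}:\Omega_0\times\Sigma_1\to[0,1]$ and $G_1^{\mathrm{fb}}:\Omega_1\times\Sigma_0\to[0,1]$ with $G_0^{\mathrm{fb}}(x,N_1(x))=1$ for every $x\in\Omega_0$ and $G_1^{\mathrm{fb}}(y,N_0(y))=1$ for every $y\in\Omega_1$. Define measures on $\Omega_0\times\Omega_1$ by $\widetilde\pi_0(A\times B)=\int_B a_0(y)(A\cap N_0(y))\,\nu_1(dy)$ and $\widetilde\pi_1(A\times B)=\int_A a_1(x)(B\cap N_1(x))\,\nu_0(dx)$, put $\widetilde\nu_\iota=(\mathrm{pr}_\iota)_\#\widetilde\pi_\iota$ (feasibility gives $\widetilde\nu_\iota\le\nu_\iota$), and set $\pi_\iota=\widetilde\pi_\iota+(\nu_\iota-\widetilde\nu_\iota)\bowtie G_\iota^{\mathrm{fb}}$. Then $\pi_\iota\in\Pi^{\mathcal E}_\iota$. *)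

(* Defs.v *)
From HB Require Import structures.
From mathcomp Require Import all_boot all_order all_algebra.
From mathcomp Require Import all_classical all_reals all_analysis.

Set Implicit Arguments.
Unset Strict Implicit.
Unset Printing Implicit Defensive.

Import Order.TTheory GRing.Theory Num.Theory.

Local Open Scope classical_set_scope.
Local Open Scope ring_scope.
Local Open Scope ereal_scope.

(* In MathComp-Analysis completeness is a property of the uniformity, so a
   metric compatible with the topology is part of the carrier structure; the
   Hausdorff property turns the pseudometric into a metric. *)
Definition polish (R : realType) (T : completePseudoMetricType R) : Prop :=
  hausdorff_space T /\ exists D : set T, countable D /\ dense D.

Definition borel (T : ptopologicalType) := g_sigma_algebraType (@open T).

HB.instance Definition _ (T : ptopologicalType) := Measurable.on (borel T).


Definition sum_display : measure_display -> measure_display -> measure_display.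
Proof. exact: (fun d0 _ => d0). Qed.

Section sum_measurable.
Context d0 d1 (T0 : measurableType d0) (T1 : measurableType d1).

HB.instance Definition _ := isPointed.Build (T0 + T1)%type (inl point).

Definition sum_measurable : set (set (T0 + T1)) :=
  [set B | measurable (inl @^-1` B) /\ measurable (inr @^-1` B)].

Let sum_measurable0 : sum_measurable set0.
Proof. by split; rewrite preimage_set0. Qed.

Let sum_measurableC B : sum_measurable B -> sum_measurable (~` B).
Proof.
by move=> [B0 B1]; split; rewrite preimage_setC; exact: measurableC.
Qed.

Let sum_measurableU (F : (set (T0 + T1))^nat) :
  (forall i, sum_measurable (F i)) -> sum_measurable (\bigcup_i F i).
Proof.
move=> mF; split; rewrite preimage_bigcup; apply: bigcupT_measurable => i;
  by have [] := mF i.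
Qed.

HB.instance Definition _ := @isMeasurable.Build (sum_display d0 d1)
  (T0 + T1)%type sum_measurable sum_measurable0 sum_measurableC
  sum_measurableU.

End sum_measurable.

Section oplus.
Context d0 d1 (T0 : measurableType d0) (T1 : measurableType d1) (R : realType).
Variables (m0 : {measure set T0 -> \bar R}) (m1 : {measure set T1 -> \bar R}).

Definition oplus (B : set (T0 + T1)) : \bar R :=
  m0 (inl @^-1` B) + m1 (inr @^-1` B).

Let oplus_set0 : oplus set0 = 0.
Proof. by rewrite /oplus !preimage_set0 !measure0 adde0. Qed.

Let oplus_ge0 B : 0 <= oplus B.
Proof. by rewrite adde_ge0. Qed.

Let oplus_sigma_additive : semi_sigma_additive oplus.
Proof.
move=> F mF tF [mU0 mU1].
have tF0 : trivIset setT (fun i => inl @^-1` F i : set T0).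
  apply/trivIsetP => i j _ _ ij; rewrite -preimage_setI.
  by move/trivIsetP : tF => /(_ _ _ I I ij) ->; rewrite preimage_set0.
have tF1 : trivIset setT (fun i => inr @^-1` F i : set T1).
  apply/trivIsetP => i j _ _ ij; rewrite -preimage_setI.
  by move/trivIsetP : tF => /(_ _ _ I I ij) ->; rewrite preimage_set0.
rewrite /oplus; under eq_fun do rewrite big_split/=.
rewrite !preimage_bigcup in mU0 mU1 *.
apply: cvgeD; first by rewrite ge0_adde_def// inE.
- by apply: measure_semi_sigma_additive => // i; have [] := mF i.
- by apply: measure_semi_sigma_additive => // i; have [] := mF i.
Qed.

HB.instance Definition _ := isMeasure.Build _ _ _ oplus
  oplus_set0 oplus_ge0 oplus_sigma_additive.

End oplus.


Section decompositions.
Context d (T : measurableType d) (R : realType).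
Implicit Types P nu mac mperp : set T -> \bar R.

Definition mutually_singular mperp nu : Prop :=
  exists A : set T, [/\ measurable A, nu A = 0 & mperp (~` A) = 0].

Definition lebesgue_decomposition P nu mac mperp : Prop :=
  [/\ forall A, measurable A -> P A = mac A + mperp A,
      mac `<< nu & mutually_singular mperp nu].

Definition is_density (r : T -> R) mac (nu : {measure set T -> \bar R}) : Prop :=
  [/\ measurable_fun setT r, forall u, (0 <= r u)%R &
      forall A, measurable A -> mac A = \int[nu]_(u in A) (r u)%:E].

End decompositions.

(* Refinements and level-optimal maximin, from a side [S] to a side [U] of the
   space [Z] of pairs. The sides are given by the projections [prs], [prt]: for
   [Z = T0 * T1] side 0 to side 1 is [fst], [snd] and side 1 to side 0 is
   [snd], [fst]. *)

Section sides.
Context dZ dS dU (Z : measurableType dZ) (S : measurableType dS)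
  (U : measurableType dU) (R : realType).
Variables (E : set Z) (prs : Z -> S) (prt : Z -> U).
Variables (nus : {finite_measure set S -> \bar R})
  (nut : {finite_measure set U -> \bar R}).

Definition refinement (pi : {finite_measure set Z -> \bar R}) : Prop :=
  pi (~` E) = 0 /\ forall A, measurable A -> pushforward pi prs A = nus A.

Definition Feas (t : R) : set {finite_measure set Z -> \bar R} :=
  [set sigma | [/\ sigma (~` E) = 0,
    forall A, measurable A -> pushforward sigma prs A <= nus A &
    forall B, measurable B -> pushforward sigma prt B <= t%:E * nut B]].

Definition Fit (t : R) : \bar R :=
  ereal_sup [set sigma [set: Z] | sigma in Feas t].

(* [r] and [Pperp] are determined up to null sets, so that quantifying them
   existentially or universally amounts to the same. *)
Definition level_optimal_maximin (pi : {finite_measure set Z -> \bar R}) : Prop :=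
  exists (r : U -> R) (Pac Pperp : {finite_measure set U -> \bar R}),
    [/\ lebesgue_decomposition (pushforward pi prt) nut Pac Pperp,
        is_density r Pac nut &
        forall t : R, (0 < t)%R ->
          \int[nut]_u (Order.min (r u) t)%:E = Fit t].

(* [sigma] is the measure eta |><| K; a finite measure is determined by its
   values on these rectangles. *)
Definition is_bowtie (eta : {measure set S -> \bar R})
    (K : S -> {measure set U -> \bar R}) (sigma : set Z -> \bar R) : Prop :=
  forall A B, measurable A -> measurable B ->
    sigma (prs @^-1` A `&` prt @^-1` B) = \int[eta]_(s in A) K s B.

End sides.

Section neighborhoods.
Context (T0 T1 : Type) (E : set (T0 * T1)).

Definition N1 (x : T0) : set T1 := [set y | E (x, y)].

Definition N0 (y : T1) : set T0 := [set x | E (x, y)].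

End neighborhoods.


Section economy.
Context d0 d1 (T0 : measurableType d0) (T1 : measurableType d1) (R : realType).
Variables (E : set (T0 * T1)) (nu0 : {finite_measure set T0 -> \bar R})
  (nu1 : {finite_measure set T1 -> \bar R}).

Local Notation T := (T0 + T1)%type.
Local Notation bundle := {finite_measure set T -> \bar R}.
Local Notation mu := (oplus nu0 nu1).

Definition bounded_measurable (q : T -> R) : Prop :=
  measurable_fun setT q /\ exists M : R, forall t, (`|q t| <= M)%R.

Definition pairing (q : T -> R) (z : {measure set T -> \bar R}) : \bar R :=
  \int[z]_s (q s)%:E.

Definition consumption (t : T) (z : bundle) : Prop :=
  match t with
  | inl x => z (inl @` (~` [set x])) = 0 /\ z (inr @` (~` N1 E x)) = 0
  | inr y => z (inr @` (~` [set y])) = 0 /\ z (inl @` (~` N0 E y)) = 0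
  end.

Definition endowment (t : T) : bundle := \d_t.

Definition utility (t : T) (z : bundle) : \bar R :=
  match t with
  | inl x => z (inr @` N1 E x)
  | inr y => z (inl @` N0 E y)
  end.

(* Measurability and integrability refer to the completion of [mu]. The
   integral \int[mu] of a function that is equal almost everywhere to a
   measurable [g] is that of [g], whether or not the function is measurable. *)
Definition ae_integrable (f : T -> \bar R) : Prop :=
  exists g, mu.-integrable setT g /\ {ae mu, forall t, f t = g t}.

Definition signed_integral (I : {charge set T -> \bar R}) (q : T -> R)
    (v : \bar R) : Prop :=
  exists (P N : set T) (PN : hahn_decomposition I P N),
    v = \int[jordan_pos PN]_s (q s)%:E - \int[jordan_neg PN]_s (q s)%:E.

Definition allocation (a : T -> bundle) : Prop :=
  [/\ {ae mu, forall t, consumption t (a t)},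
      forall q, bounded_measurable q -> ae_integrable (fun t => pairing q (a t)) &
      exists I : {charge set T -> \bar R}, forall q, bounded_measurable q ->
        signed_integral I q (\int[mu]_t pairing q (a t))].

Definition feasible (a : T -> bundle) : Prop :=
  forall B, measurable B -> \int[mu]_t a t B = \int[mu]_t endowment t B.

Definition budget (p : T -> R) (t : T) (z : bundle) : Prop :=
  consumption t z /\ pairing p z <= pairing p (endowment t).

Definition walrasian_equilibrium (a : T -> bundle) (p : T -> R) : Prop :=
  [/\ bounded_measurable p,
      forall t, (0 <= p t)%R,
      exists t, p t <> 0%R,
      allocation a /\ feasible a &
      {ae mu, forall t, budget p t (a t) /\
        ~ exists z, budget p t z /\ utility t (a t) < utility t z}].

End economy.


Section density_decomposition.
Context d (T : measurableType d) (R : realType).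
Variables (P : set T -> \bar R) (nu : {finite_measure set T -> \bar R}).

Record density_decomposition := DensityDecomposition {
  dd_Pac : {finite_measure set T -> \bar R};
  dd_Pperp : {finite_measure set T -> \bar R};
  dd_rho : T -> R;
  dd_nuac : {finite_measure set T -> \bar R};
  dd_nuperp : {finite_measure set T -> \bar R};
  dd_Sac : set T;
  dd_Sperp : set T;
  dd_P_decomposition : lebesgue_decomposition P nu dd_Pac dd_Pperp;
  dd_rho_density : is_density dd_rho dd_Pac nu;
  dd_nu_decomposition : lebesgue_decomposition nu dd_Pac dd_nuac dd_nuperp;
  dd_Sac_measurable : measurable dd_Sac;
  dd_Sperp_measurable : measurable dd_Sperp;
  dd_disjoint : dd_Sac `&` dd_Sperp = set0;
  dd_nuac_carrier : dd_nuac (~` dd_Sac) = 0;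
  dd_nuperp_carrier : dd_nuperp (~` dd_Sperp) = 0 }.

End density_decomposition.

Section constructions.
Context d0 d1 (T0 : measurableType d0) (T1 : measurableType d1) (R : realType).
Variables (E : set (T0 * T1)) (nu0 : {finite_measure set T0 -> \bar R})
  (nu1 : {finite_measure set T1 -> \bar R}).
Variables (pi0 pi1 : {finite_measure set (T0 * T1)%type -> \bar R}).

Local Notation T := (T0 + T1)%type.
Local Notation bundle := {finite_measure set T -> \bar R}.
Local Notation decomposition0 := (density_decomposition (pushforward pi1 fst) nu0).
Local Notation decomposition1 := (density_decomposition (pushforward pi0 snd) nu1).

Definition exceptional_sets (D0 : decomposition0) (D1 : decomposition1)
    (M0 : set T0) (M1 : set T1) : Prop :=
  [/\ measurable M0 /\ nu0 M0 = 0,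
      measurable M1 /\ nu1 M1 = 0,
      \bigcup_(x in dd_Sac D0)
        [set y | N1 E x y /\ (dd_rho D0 x * dd_rho D1 y < 1)%R] `<=` M1 /\
      \bigcup_(x in dd_Sperp D0) N1 E x `<=` M1 &
      \bigcup_(y in dd_Sac D1)
        [set x | N0 E y x /\ (dd_rho D1 y * dd_rho D0 x < 1)%R] `<=` M0 /\
      \bigcup_(y in dd_Sperp D1) N0 E y `<=` M0].

(* Finite kernels are [R.-ftker] (each [K x] is finite) since the masses of
   [K0] and [K1] need not be uniformly bounded, as they are for [R.-fker]. *)
Definition exchange_kernels (D0 : decomposition0) (D1 : decomposition1)
    (K0 : R.-ftker T1 ~> T0) (K1 : R.-ftker T0 ~> T1) : Prop :=
  exists (G0 : R.-pker T0 ~> T1) (G1 : R.-pker T1 ~> T0)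
         (pi0ac pi1ac : {finite_measure set (T0 * T1)%type -> \bar R}),
    [/\ is_bowtie fst snd nu0 G0 pi0 /\ is_bowtie snd fst nu1 G1 pi1,
        is_bowtie fst snd (dd_nuac D0) G0 pi0ac,
        is_bowtie snd fst (dd_nuac D1) G1 pi1ac,
        is_bowtie snd fst (dd_nuac D1) K0 pi0ac &
        is_bowtie fst snd (dd_nuac D0) K1 pi1ac].

Definition induced_allocation (D0 : decomposition0) (D1 : decomposition1)
    (K0 : T1 -> {measure set T0 -> \bar R})
    (K1 : T0 -> {measure set T1 -> \bar R}) (a : T -> bundle) : Prop :=
  forall B, measurable B ->
  (forall x,
    [/\ dd_Sac D0 x -> a (inl x) B = oplus mzero (K1 x) B,
        dd_Sperp D0 x -> a (inl x) B = oplus \d_x mzero B &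
        ~ (dd_Sac D0 x \/ dd_Sperp D0 x) -> a (inl x) B = \d_(inl x : T) B]) /\
  (forall y,
    [/\ dd_Sac D1 y -> a (inr y) B = oplus (K0 y) mzero B,
        dd_Sperp D1 y -> a (inr y) B = oplus mzero (\d_y) B &
        ~ (dd_Sac D1 y \/ dd_Sperp D1 y) -> a (inr y) B = \d_(inr y : T) B]).

Definition induced_price (D0 : decomposition0) (D1 : decomposition1)
    (M0 : set T0) (M1 : set T1) (p : T -> R) : Prop :=
  (forall x,
    [/\ M0 x \/ ~ (dd_Sac D0 x \/ dd_Sperp D0 x) -> p (inl x) = 2%R,
        ~ M0 x -> dd_Sac D0 x ->
          p (inl x) = (dd_rho D0 x / (1 + dd_rho D0 x))%R &
        ~ M0 x -> dd_Sperp D0 x -> p (inl x) = 0%R]) /\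
  (forall y,
    [/\ M1 y \/ ~ (dd_Sac D1 y \/ dd_Sperp D1 y) -> p (inr y) = 2%R,
        ~ M1 y -> dd_Sac D1 y ->
          p (inr y) = (dd_rho D1 y / (1 + dd_rho D1 y))%R &
        ~ M1 y -> dd_Sperp D1 y -> p (inr y) = 0%R]).

Definition induced_pair (a : T -> bundle) (p : T -> R) : Prop :=
  exists (D0 : decomposition0) (D1 : decomposition1) (M0 : set T0) (M1 : set T1)
         (K0 : R.-ftker T1 ~> T0) (K1 : R.-ftker T0 ~> T1),
    [/\ exceptional_sets D0 D1 M0 M1,
        exchange_kernels D0 D1 K0 K1,
        induced_allocation D0 D1 K0 K1 a &
        induced_price D0 D1 M0 M1 p].

(* [gap0], [gap1] are the differences of [nu0], [nu1] with the marginals of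
   [tpi0], [tpi1]. *)
Definition extracted_pair (a : T -> bundle) : Prop :=
  exists (G0 : R.-pker T0 ~> T1) (G1 : R.-pker T1 ~> T0)
         (tpi0 tpi1 : {finite_measure set (T0 * T1)%type -> \bar R})
         (gap0 : {finite_measure set T0 -> \bar R})
         (gap1 : {finite_measure set T1 -> \bar R})
         (fill0 fill1 : {finite_measure set (T0 * T1)%type -> \bar R}),
    [/\ (forall x, G0 x (N1 E x) = 1) /\ (forall y, G1 y (N0 E y) = 1),
        (forall A B, measurable A -> measurable B ->
          tpi0 (A `*` B) = \int[nu1]_(y in B) a (inr y) (inl @` (A `&` N0 E y))) /\
        (forall A B, measurable A -> measurable B ->
          tpi1 (A `*` B) = \int[nu0]_(x in A) a (inl x) (inr @` (B `&` N1 E x))),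
        (forall A, measurable A -> nu0 A = pushforward tpi0 fst A + gap0 A) /\
        (forall B, measurable B -> nu1 B = pushforward tpi1 snd B + gap1 B),
        is_bowtie fst snd gap0 G0 fill0 /\ is_bowtie snd fst gap1 G1 fill1 &
        (forall C, measurable C -> pi0 C = tpi0 C + fill0 C) /\
        (forall C, measurable C -> pi1 C = tpi1 C + fill1 C)].

End constructions.

(* Main.v *)
Require Import Defs.
From HB Require Import structures.
From mathcomp Require Import all_boot all_order all_algebra.
From mathcomp Require Import all_classical all_reals all_analysis.
From mathcomp Require Import measurable_realfun ring lra.

(* Proof idea. In both directions the heart is a Walras-law argument: two
   integrals that bound each other must agree, so pointwise inequalities between
   their integrands are equalities almost everywhere.

   (1) On S^ac the mass of the exchange kernel is the density rho. The null sets
   M make every neighbor of an agent with density rho cost at least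
   1 / (1 + rho), while the agent is worth rho / (1 + rho). Hence each induced
   bundle costs at least the income of its owner; as the allocation redistributes
   mu, total cost and total income coincide, so the budgets hold with equality,
   and the same lower price bound shows that no affordable bundle is better.

   (2) Let w be the equilibrium utility. Buying a multiple of one neighbor t' is
   not profitable for t, so p t <= w t * p t' with p t' > 0; hence
   w x * w y >= 1 along the edges, off null sets. The extracted measure pi~_1 has
   marginals w nu_0 and at most nu_1, and 1 / (1 + w x) <= w y / (1 + w y), so
     int w / (1 + w) dnu_0 = int 1 / (1 + w x) dpi~_1
       <= int w y / (1 + w y) dpi~_1 <= int w / (1 + w) dnu_1,
   and symmetrically. Therefore w x * w y = 1 for pi~-almost every pair and only
   agents with w = 0 are left unmatched; their fillings live on null sets of the
   other side, so w is the density of the marginal. For feasible sigma, splitting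
   at w y = t gives the upper bound: where w y <= t, sigma sees at most
   nu_0 {w >= 1 / t}, which is what pi~_0 sends to {w <= t}. The lower bound is
   attained by pi~_0 with weights min (1, t / w y). *)

Set Implicit Arguments.
Unset Strict Implicit.
Unset Printing Implicit Defensive.

Import Order.TTheory GRing.Theory Num.Theory.

Local Open Scope classical_set_scope.
Local Open Scope ring_scope.
Local Open Scope ereal_scope.

(** * Integration *)

Section mixture.
Import HBNNSimple.
Context dX dY (X : measurableType dX) (Y : measurableType dY) (R : realType).
Variables (eta : {measure set X -> \bar R}) (m : {measure set Y -> \bar R}).
Variable K : X -> {measure set Y -> \bar R}.
Hypothesis mK : forall B, measurable B -> measurable_fun setT (K ^~ B).
Hypothesis mE : forall B, measurable B -> m B = \int[eta]_x K x B.

Let mixture_nnsfun (f : {nnsfun Y >-> R}) :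
  \int[m]_y (f y)%:E = \int[eta]_x \int[K x]_y (f y)%:E.
Proof.
under [RHS]eq_integral do rewrite integralT_nnsfun sintegralE.
rewrite integralT_nnsfun sintegralE ge0_integral_fsum//; first last.
- by move=> r x _; exact: nnsfun_mulemu_ge0.
- by move=> r; apply: measurable_funeM; exact: mK.
- apply: eq_fsbigr => r /[1!inE] -[y _ <-].
  rewrite ge0_integralZl//.
  + by rewrite mE.
  + exact: mK.
  + by rewrite lee_fin.
Qed.

(** Hypothesis [mE] is the case of indicators. It extends to simple functions by linearity, and then
    by monotone convergence, applied under each [K x] as well as under [m] and [eta]. *)
Lemma ge0_integral_mixture (f : Y -> \bar R) :
  (forall y, 0 <= f y) -> measurable_fun setT f ->
  \int[m]_y f y = \int[eta]_x \int[K x]_y f y.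
Proof.
move=> f0 mf.
pose f_ := nnsfun_approx measurableT mf.
have mono (mu : {measure set Y -> \bar R}) :
    \int[mu]_y f y = limn (fun n => \int[mu]_y (f_ n y)%:E).
  rewrite -monotone_convergence//.
  - apply: eq_integral => y _; apply/esym/cvg_lim => //.
    exact: cvg_nnsfun_approx.
  - by move=> n; exact/measurable_EFinP.
  - by move=> n y _; rewrite lee_fin.
  - by move=> y _ i j ij; rewrite lee_fin; exact/lefP/nd_nnsfun_approx.
under [RHS]eq_integral do rewrite mono.
rewrite mono monotone_convergence//.
- by congr (limn _); apply/funext => n; exact: mixture_nnsfun.
- move=> n; apply: measurable_fun_integral_kernel => //.
  + by move=> y; rewrite lee_fin.
  + exact/measurable_EFinP.
- by move=> n x _; apply: integral_ge0 => y _; rewrite lee_fin.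
- move=> x _ i j ij; apply: ge0_le_integral => //.
  + by move=> y _; rewrite lee_fin.
  + exact/measurable_EFinP.
  + exact/measurable_EFinP.
  + by move=> y _; rewrite lee_fin; exact/lefP/nd_nnsfun_approx.
Qed.

End mixture.

Section density.
Context d (T : measurableType d) (R : realType).
Variables (m nu : {measure set T -> \bar R}) (w : T -> R).
Hypothesis mw : measurable_fun setT w.
Hypothesis w0 : forall x, (0 <= w x)%R.
Hypothesis mE : forall B, measurable B -> m B = \int[nu]_(x in B) (w x)%:E.

(** A measure with density [w] is the mixture over [nu] of the point masses of weight [w x] at
    [x]. *)
Lemma ge0_integral_density (f : T -> \bar R) :
  (forall x, 0 <= f x) -> measurable_fun setT f ->
  \int[m]_x f x = \int[nu]_x ((w x)%:E * f x).
Proof.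
move=> f0 mf.
pose K x : {measure set T -> \bar R} := mscale (NngNum (w0 x)) \d_x.
have KE x B : K x B = (w x)%:E * (\1_B x)%:E by [].
rewrite (@ge0_integral_mixture _ _ _ _ _ nu m K)//.
- by apply: eq_integral => x _; rewrite ge0_integral_mscale// integral_dirac// diracT mul1e.
- move=> B mB; under eq_fun do rewrite KE.
  apply: emeasurable_funM; first exact/measurable_EFinP.
  exact/measurable_EFinP/measurable_indic.
- move=> B mB; rewrite mE// integral_mkcond; apply: eq_integral => x _.
  by rewrite KE patchE indicE; case: ifPn => _; rewrite ?mule1 ?mule0.
Qed.

End density.

(** * Null sets, nonmeasurable integrands and equality cases *)

Section integral_lemmas.
Import HBNNSimple.
Context d (T : measurableType d) (R : realType).
Implicit Types (mu : {measure set T -> \bar R}) (f g : T -> \bar R).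

(** A simple function below [f] keeps its integral when it is set to zero on [N], and the result
    competes in the supremum for [f] on the complement. Hence measurability of [f] is never
    invoked. *)
Let ge0_negligible_integralT mu (N : set T) f : measurable N -> mu N = 0 ->
  (forall x, 0 <= f x) -> \int[mu]_x f x <= \int[mu]_(x in ~` N) f x.
Proof.
move=> mN N0 f0; rewrite [X in X <= _]ge0_integralTE//.
apply: ge_ereal_sup => _ [h hf <-].
rewrite -integralT_nnsfun (@ge0_negligible_integral _ _ _ _ setT N)//; last 2 first.
- exact/measurable_EFinP.
- by move=> x _; rewrite lee_fin.
rewrite setTD integral_mkcond [leRHS]ge0_integralE//.
apply: ereal_sup_ubound.
exists (proj_nnsfun h (measurableC mN)).
  move=> x /=; rewrite patchE mindicE; case: ifPn => _.
    by rewrite mulr1; exact: hf.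
  by rewrite mulr0.
rewrite -integralT_nnsfun; apply: eq_integral => x _.
by rewrite patchE/= mindicE; case: ifPn => _; rewrite ?mulr1 ?mulr0.
Qed.

(* The integral of a nonnegative function is a supremum over simple functions,
   so [f] is not required to be measurable. *)
Lemma ge0_ae_eq_integral_nonmeasurable mu (D : set T) f g : measurable D ->
  (forall x, 0 <= f x) -> (forall x, 0 <= g x) -> measurable_fun setT g ->
  {ae mu, forall x, f x = g x} -> \int[mu]_(x in D) f x = \int[mu]_(x in D) g x.
Proof.
move=> mD f0 g0 mg [N [mN N0 fgN]].
have off (h : T -> \bar R) : (forall x, 0 <= h x) ->
    \int[mu]_(x in D) h x = \int[mu]_(x in D `&` ~` N) h x.
  move=> h0; rewrite integral_mkcondr.
  rewrite [in LHS]integral_mkcond [in RHS]integral_mkcond.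
  have -> : (h \_ (~` N)) \_ D = (h \_ D) \_ (~` N).
    by rewrite -!patch_setI setIC.
  have hD x : 0 <= (h \_ D) x by rewrite patchE; case: ifPn.
  apply/eqP; rewrite eq_le -[X in _ <= X]integral_mkcond ge0_negligible_integralT//=.
  rewrite [leLHS]ge0_integralTE; last by move=> x; rewrite patchE; case: ifPn.
  rewrite [leRHS]ge0_integralTE//; apply: le_ereal_sup => _ [k kh <-].
  exists k => // x; apply: le_trans (kh x) _.
  by rewrite [X in X <= _]patchE; case: ifPn.
rewrite off// [RHS]off//; apply: eq_integral => x /[1!inE] -[_ Nx].
by apply: contrapT => fg; apply/Nx/fgN.
Qed.

Lemma ge0_integral_carrier mu (m : {measure set T -> \bar R}) (D C : set T) f :
  measurable D -> measurable C ->
  (forall B, measurable B -> m B = mu (B `&` C)) ->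
  (forall x, 0 <= f x) -> measurable_fun setT f ->
  \int[m]_(x in D) f x = \int[mu]_(x in D `&` C) f x.
Proof.
move=> mD mC mE f0 mf.
rewrite (@ge0_negligible_integral _ _ _ _ D (~` C))//.
- rewrite setDE setCK; apply: eq_measure_integral => A mA AC.
  by rewrite mE//; congr (mu _); apply/setIidPl => x /AC[].
- exact: measurableC.
- exact: measurable_funTS.
- by rewrite mE ?setICl ?measure0//; exact: measurableC.
Qed.

Lemma ge0_ae_eq0 mu (D : set T) f : measurable D -> measurable_fun D f ->
  (forall x, 0 <= f x) -> \int[mu]_(x in D) f x = 0 ->
  {ae mu, forall x, D x -> f x = 0}.
Proof.
move=> mD mf f0 f00; apply: (ae_eq_integral_abs mu mD mf).1.
by under eq_integral do rewrite gee0_abs//.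
Qed.

(** This is the form in which the Walras-law argument is used: finiteness lets the common integral
    be cancelled, so the nonnegative difference has integral zero. *)
Lemma ae_eq_of_eq_integral mu (f g : T -> R) :
  measurable_fun setT f -> measurable_fun setT g ->
  (forall x, 0 <= f x)%R -> (forall x, 0 <= g x)%R ->
  \int[mu]_x (g x)%:E < +oo -> {ae mu, forall x, (f x <= g x)%R} ->
  \int[mu]_x (f x)%:E = \int[mu]_x (g x)%:E -> {ae mu, forall x, f x = g x}.
Proof.
move=> mf mg f0 g0 goo fg eqfg.
(* The positive part is nonnegative everywhere, whereas [g - f] is so only almost everywhere. *)
pose h x := Num.max 0%R (g x - f x)%R.
have mh : measurable_fun setT h.
  by apply: measurable_maxr => //; exact: measurable_funB.
have h0 x : (0 <= h x)%R by rewrite /h le_max lexx.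
have hE : {ae mu, forall x, h x = (g x - f x)%R}.
  by apply: filterS fg => x fgx; apply/max_idPr; rewrite subr_ge0.
have Efh : \int[mu]_x (f x)%:E + \int[mu]_x (h x)%:E = \int[mu]_x (g x)%:E.
  rewrite -ge0_integralD//.
  - apply: ge0_ae_eq_integral => //.
    + by apply: emeasurable_funD; exact/measurable_EFinP.
    + exact/measurable_EFinP.
    + by move=> x _; rewrite adde_ge0// lee_fin.
    + by move=> x _; rewrite lee_fin.
    + apply: filterS hE => x -> _; congr EFin; lra.
  - by move=> x _; rewrite lee_fin.
  - exact/measurable_EFinP.
  - by move=> x _; rewrite lee_fin.
  - exact/measurable_EFinP.
have gfin : \int[mu]_x (g x)%:E \is a fin_num.
  by rewrite ge0_fin_numE// integral_ge0// => x _; rewrite lee_fin.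
have h00 : \int[mu]_x (h x)%:E = 0.
  move: Efh; rewrite eqfg => /(congr1 (fun z => z - \int[mu]_x (g x)%:E)).
  by rewrite addeAC subee// add0e.
have := ge0_ae_eq0 measurableT.
move=> /(_ mu (EFin \o h)) => /(_ _ _ h00) H.
have {}H : {ae mu, forall x, h x = 0%R}.
  have mh' : measurable_fun setT (EFin \o h) by exact/measurable_EFinP.
  have := H mh' (fun x => h0 x).
  by apply: filterS => x /(_ I)/= [].
apply: filterS2 hE H => x -> /eqP; rewrite subr_eq0 => /eqP ->//.
Qed.

Lemma ge0_integral_measureD (m m1 m2 : {measure set T -> \bar R}) f :
  (forall B, measurable B -> m B = m1 B + m2 B) ->
  (forall x, 0 <= f x) -> measurable_fun setT f ->
  \int[m]_x f x = \int[m1]_x f x + \int[m2]_x f x.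
Proof.
move=> mE f0 mf.
rewrite (eq_measure_integral (measure_add m1 m2)); last first.
  by move=> A mA _; rewrite mE// /measure_add/= /msum !big_ord_recl/= big_ord0 adde0.
by rewrite ge0_integral_measure_add.
Qed.

End integral_lemmas.

Section image_measure.
Context d d' (T : measurableType d) (U : measurableType d') (R : realType).
Variables (m : {measure set T -> \bar R}) (f : T -> U).
Hypothesis mf : measurable_fun setT f.

(* [pushforward] with the measurability proof as an argument, so that the
   canonical measure structure can be inferred. *)
Definition image_measure of measurable_fun setT f := pushforward m f.

Let pm : {measure set U -> \bar R} :=
  measure_function_pushforward__canonical__measure_function_Measure m mf.

HB.instance Definition _ := isMeasure.Build _ _ _ (image_measure mf)
  (measure0 pm) (fun A => measure_ge0 pm A) (@measure_semi_sigma_additive _ _ _ pm).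

Lemma ge0_integral_image (m' : {measure set U -> \bar R}) (g : U -> \bar R) :
  (forall B, measurable B -> m' B = m (f @^-1` B)) ->
  (forall u, 0 <= g u) -> measurable_fun setT g ->
  \int[m']_u g u = \int[m]_t g (f t).
Proof.
move=> m'E g0 mg; rewrite (eq_measure_integral pm)//; last by move=> A mA _; exact: m'E.
exact: (@ge0_integral_pushforward _ _ _ _ _ _ mf m setT g measurableT mg (fun u _ => g0 u)).
Qed.

End image_measure.

Section finite_image_measure.
Context d d' (T : measurableType d) (U : measurableType d') (R : realType).
Variables (m : {finite_measure set T -> \bar R}) (f : T -> U).
Hypothesis mf : measurable_fun setT f.

Let fin_image_measure : fin_num_fun (image_measure m mf).
Proof.
move=> A mA; apply: fin_num_measure.
by have := mf measurableT mA; rewrite setTI.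
Qed.

HB.instance Definition _ := @Measure_isFinite.Build _ _ _
  (image_measure m mf) fin_image_measure.

End finite_image_measure.

(** * Measures and integrals on a disjoint union *)

Section oplus_theory.
Context d0 d1 (T0 : measurableType d0) (T1 : measurableType d1) (R : realType).

Lemma measurable_inl : measurable_fun setT (@inl T0 T1).
Proof. by move=> _ B [mB _]; rewrite setTI. Qed.

Lemma measurable_inr : measurable_fun setT (@inr T0 T1).
Proof. by move=> _ B [_ mB]; rewrite setTI. Qed.

Lemma measurable_fun_sumtype d (U : measurableType d) (f : T0 + T1 -> U) :
  measurable_fun setT (f \o inl) -> measurable_fun setT (f \o inr) ->
  measurable_fun setT f.
Proof.
move=> m0 m1 _ B mB; rewrite setTI; split.
- by have := m0 measurableT B mB; rewrite setTI.
- by have := m1 measurableT B mB; rewrite setTI.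
Qed.

Lemma preimage_inl_inl (A : set T0) : @inl T0 T1 @^-1` (inl @` A) = A.
Proof. by apply/seteqP; split=> [x [y Ay [<-]]//|x Ax]; exists x. Qed.

Lemma preimage_inr_inr (A : set T1) : @inr T0 T1 @^-1` (inr @` A) = A.
Proof. by apply/seteqP; split=> [x [y Ay [<-]]//|x Ax]; exists x. Qed.

Lemma preimage_inl_inr (A : set T1) : @inl T0 T1 @^-1` (inr @` A) = set0.
Proof. by apply/seteqP; split=> [x []|]. Qed.

Lemma preimage_inr_inl (A : set T0) : @inr T0 T1 @^-1` (inl @` A) = set0.
Proof. by apply/seteqP; split=> [x []|]. Qed.

Lemma measurable_image_inl (A : set T0) : measurable A -> measurable (@inl T0 T1 @` A).
Proof.
move=> mA; split; first by rewrite preimage_inl_inl.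
by rewrite preimage_inr_inl.
Qed.

Lemma measurable_image_inr (A : set T1) : measurable A -> measurable (@inr T0 T1 @` A).
Proof.
move=> mA; split; last by rewrite preimage_inr_inr.
by rewrite preimage_inl_inr.
Qed.

Variables (m0 : {measure set T0 -> \bar R}) (m1 : {measure set T1 -> \bar R}).

Lemma ae_oplus (Q : T0 + T1 -> Prop) :
  {ae oplus m0 m1, forall t, Q t} <->
  {ae m0, forall x, Q (inl x)} /\ {ae m1, forall y, Q (inr y)}.
Proof.
split=> [[N [[mN0 mN1] N0 QN]]|[[N [mN N0 QN]] [M [mM M0 QM]]]].
  move/eqP: N0; rewrite /oplus padde_eq0// => /andP[/eqP N0 /eqP N1].
  by split; [exists (inl @^-1` N)|exists (inr @^-1` N)]; split => // x; exact: QN.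
exists ((inl @` N) `|` (inr @` M)); split.
- apply: measurableU; [exact: measurable_image_inl|exact: measurable_image_inr].
- rewrite /oplus !preimage_setU preimage_inl_inl preimage_inr_inr.
  by rewrite preimage_inl_inr preimage_inr_inl setU0 set0U N0 M0 adde0.
- by move=> [x|y] /= nQ; [left; exists x => //; exact: QN|right; exists y => //; exact: QM].
Qed.

Lemma ge0_integral_oplus (f : T0 + T1 -> \bar R) :
  (forall t, 0 <= f t) -> measurable_fun setT f ->
  \int[oplus m0 m1]_t f t = \int[m0]_x f (inl x) + \int[m1]_y f (inr y).
Proof.
move=> f0 mf.
rewrite (@ge0_integral_measureD _ _ _ _ (image_measure m0 measurable_inl)
  (image_measure m1 measurable_inr))//.
congr (_ + _); apply: ge0_integral_image => //.
  exact: measurable_inl.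
exact: measurable_inr.
Qed.

End oplus_theory.

Section finite_oplus.
Context d0 d1 (T0 : measurableType d0) (T1 : measurableType d1) (R : realType).
Variables (m0 : {finite_measure set T0 -> \bar R}).
Variables (m1 : {finite_measure set T1 -> \bar R}).

Let fin_oplus : fin_num_fun (oplus m0 m1).
Proof. by move=> A [mA0 mA1]; rewrite fin_numD !fin_num_measure. Qed.

HB.instance Definition _ := @Measure_isFinite.Build _ _ _
  (oplus m0 m1) fin_oplus.

End finite_oplus.

(** * Neighborhoods and disintegrations *)

Section neighborhood_relation.
Context dZ dS dU (Z : measurableType dZ) (S : measurableType dS)
  (U : measurableType dU) (R : realType).
Variables (E : set Z) (prs : Z -> S) (prt : Z -> U) (Nb : S -> set U).
Variables (F : nat -> set S) (G : nat -> set U).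
Hypotheses (mprs : measurable_fun setT prs) (mprt : measurable_fun setT prt).
Hypothesis ENb : forall z, E z <-> Nb (prs z) (prt z).
Hypotheses (mF : forall i, measurable (F i)) (mG : forall i, measurable (G i)).
Hypothesis NbC : forall s u, ~ Nb s u <-> exists i, F i s /\ G i u.

(** Claims about non-edges are reduced to these countably many rectangles, because [is_bowtie] and
    the extraction formulas evaluate measures on rectangles only. *)
Lemma setC_edge : ~` E = \bigcup_i (prs @^-1` F i `&` prt @^-1` G i).
Proof.
apply/seteqP; split=> [z nEz|z [i _ [Fi Gi]] /ENb].
  by have [|i [Fi Gi]] := (NbC (prs z) (prt z)).1; [exact/(contra_not (ENb z).2)|exists i].
by apply/NbC; exists i.
Qed.

Let mrect i : measurable (prs @^-1` F i `&` prt @^-1` G i).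
Proof.
apply: measurableI.
  by have := mprs measurableT (mF i); rewrite setTI.
by have := mprt measurableT (mG i); rewrite setTI.
Qed.

Lemma measurable_edgeC : measurable (~` E).
Proof. by rewrite setC_edge; exact: bigcupT_measurable. Qed.

Lemma setC_neighborhood s : ~` Nb s = \bigcup_(i in [set i | F i s]) G i.
Proof.
apply/seteqP; split=> [u /NbC[i [Fi Gi]]|u [i Fi Gi]]; first by exists i.
by apply/NbC; exists i.
Qed.

Lemma measurable_neighborhoodC s : measurable (~` Nb s).
Proof. by rewrite setC_neighborhood; apply: bigcup_measurable => i _. Qed.

Lemma measurable_neighborhood s : measurable (Nb s).
Proof. by rewrite -(setCK (Nb s)); apply: measurableC; exact: measurable_neighborhoodC. Qed.

Lemma null_edgeC (sigma : {measure set Z -> \bar R}) :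
  (forall i, sigma (prs @^-1` F i `&` prt @^-1` G i) = 0) -> sigma (~` E) = 0.
Proof.
move=> s0; rewrite setC_edge; apply: (@measure_negligible _ _ _ sigma) => //.
  exact: bigcupT_measurable.
by apply: negligible_bigcup => i; apply/negligibleP; [exact: mrect|exact: s0].
Qed.

Variables (eta : {measure set S -> \bar R}) (K : S -> {measure set U -> \bar R}).
Variable sigma : {measure set Z -> \bar R}.
Hypothesis mK : forall B, measurable B -> measurable_fun setT (fun s => K s B).
Hypothesis bow : is_bowtie prs prt eta K sigma.

(** On each rectangle the integral of [K s (G i)] over [F i] vanishes, so the integrand does almost
    everywhere on [F i]. Countability gives one null set for all [i], and the [G i] with [F i s]
    cover the complement of [Nb s]. *)
Lemma bowtie_neighborhood : sigma (~` E) = 0 ->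
  {ae eta, forall s, K s (~` Nb s) = 0}.
Proof.
move=> sE0.
have rect i : {ae eta, forall s, F i s -> K s (G i) = 0}.
  apply: ge0_ae_eq0 => //; first by apply: measurable_funTS; exact: mK.
  rewrite -bow//; apply/eqP; rewrite -measure_le0 -sE0 le_measure ?inE//.
    exact: measurable_edgeC.
  by rewrite setC_edge => z; exists i.
apply: filterS (ae_foralln rect) => s Fs0.
rewrite setC_neighborhood; apply: (@measure_negligible _ _ _ (K s)).
  by apply: bigcup_measurable => i _.
rewrite bigcup_mkcond; apply: negligible_bigcup => i; case: ifPn => [/[1!inE] Fis|_].
  by apply/negligibleP => //; exact: Fs0.
exact: negligible_set0.
Qed.

Lemma neighborhood_bowtie : (forall s, K s (~` Nb s) = 0) -> sigma (~` E) = 0.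
Proof.
move=> K0; apply: null_edgeC => i; rewrite bow//.
apply: integral0_eq => s Fis; apply/eqP; rewrite -measure_le0 -(K0 s).
rewrite le_measure ?inE//; first exact: measurable_neighborhoodC.
by rewrite setC_neighborhood => u Gu; exists i.
Qed.

End neighborhood_relation.

(** * Level-optimality from reciprocal utilities *)

Lemma measurable_fun_invr d (T : measurableType d) (R : realType) (f : T -> R) :
  (forall x, 0 < f x)%R -> measurable_fun setT f ->
  measurable_fun setT (fun x => (f x)^-1)%R.
Proof.
move=> f0 mf; rewrite (_ : (fun x => _) = (fun x => powR (f x) (-1))%R).
  by apply: (measurableT_comp (@measurable_powR R (-1))).
by apply/funext => x; rewrite powR_inv1// ltW.
Qed.

(** * Comparing the values of two sides joined by a trade *)

Section trade.
Context dZ dS dU (Z : measurableType dZ) (S : measurableType dS)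
  (U : measurableType dU) (R : realType).
Variables (prs : Z -> S) (prt : Z -> U).
Hypotheses (mprs : measurable_fun setT prs) (mprt : measurable_fun setT prt).
Variables (nus : {finite_measure set S -> \bar R})
  (nut gapt : {finite_measure set U -> \bar R}).
Variables (ws : S -> R) (wt : U -> R) (beta : {finite_measure set Z -> \bar R}).
Hypotheses (mws : measurable_fun setT ws) (mwt : measurable_fun setT wt).
Hypotheses (ws0 : forall s, (0 <= ws s)%R) (wt0 : forall u, (0 <= wt u)%R).
Hypothesis beta_s : forall A, measurable A ->
  beta (prs @^-1` A) = \int[nus]_(s in A) (ws s)%:E.
Hypothesis beta_t : forall B, measurable B ->
  nut B = beta (prt @^-1` B) + gapt B.
Hypothesis beta_ge1 : {ae beta, forall z, (1 <= ws (prs z) * wt (prt z))%R}.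

(** [q] is the price formula of the induced construction, and [q x = x * q' x]. For positive [x],
    [q' x = q (1 / x)]; as [q] increases, [x * y >= 1] gives [q' x <= q y], with equality only if
    [x * y = 1]. *)
Let q (x : R) : R := (x / (1 + x))%R.
Let q' (x : R) : R := (1 + x)^-1%R.

Let q_ge0 x : (0 <= x)%R -> (0 <= q x)%R.
Proof. by move=> x0; rewrite /q divr_ge0// addr_ge0. Qed.

Let q'_ge0 x : (0 <= x)%R -> (0 <= q' x)%R.
Proof. by move=> x0; rewrite /q' invr_ge0 addr_ge0. Qed.

Let q_le1 x : (0 <= x)%R -> (q x <= 1)%R.
Proof. by move=> x0; rewrite /q ler_pdivrMr ?mul1r ?lerDr// ltr_wpDr. Qed.

Let measurable_q' d (V : measurableType d) (f : V -> R) :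
  (forall v, 0 <= f v)%R -> measurable_fun setT f -> measurable_fun setT (q' \o f).
Proof.
by move=> f0 mf; apply: measurable_fun_invr => [v|]; [rewrite ltr_wpDr|exact: measurable_funD].
Qed.

Let measurable_q d (V : measurableType d) (f : V -> R) :
  (forall v, 0 <= f v)%R -> measurable_fun setT f -> measurable_fun setT (q \o f).
Proof. by move=> f0 mf; apply: measurable_funM => //; exact: measurable_q'. Qed.

Let q'_le_q x y : (0 <= x)%R -> (0 <= y)%R -> (1 <= x * y)%R -> (q' x <= q y)%R.
Proof.
move=> x0 y0 xy1; rewrite /q /q' ler_pdivlMr ?ltr_wpDr// mulrC ler_pdivrMr ?ltr_wpDr//.
lra.
Qed.

Let q'_eq_q x y : (0 <= x)%R -> (0 <= y)%R -> (q' x = q y)%R -> (x * y = 1)%R.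
Proof.
move=> x0 y0; rewrite /q /q'.
have x1 : (1 + x != 0)%R by rewrite gt_eqF// ltr_wpDr.
have y1 : (1 + y != 0)%R by rewrite gt_eqF// ltr_wpDr.
move/(congr1 (fun r => r * ((1 + x) * (1 + y)))%R).
have -> : ((1 + x)^-1 * ((1 + x) * (1 + y)) = 1 + y)%R by field.
have -> : (y / (1 + y) * ((1 + x) * (1 + y)) = y * (1 + x))%R by field.
lra.
Qed.

Let fin_q d (V : measurableType d) (nu : {finite_measure set V -> \bar R}) (f : V -> R) :
  (forall v, 0 <= f v)%R -> measurable_fun setT f -> \int[nu]_v (q (f v))%:E < +oo.
Proof.
move=> f0 mf.
apply: (@le_lt_trans _ _ (\int[nu]_v (cst 1 v))).
  apply: ge0_le_integral => //.
  - by move=> v _; rewrite lee_fin q_ge0.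
  - exact/measurable_EFinP/measurable_q.
  - by move=> v _; rewrite lee_fin q_le1.
by rewrite integral_cst// mul1e ltey_eq fin_num_measure.
Qed.

Let beta_q'E : \int[nus]_s (q (ws s))%:E = \int[beta]_z (q' (ws (prs z)))%:E.
Proof.
pose f s : \bar R := (q' (ws s))%:E.
have f0 s : 0 <= f s by rewrite lee_fin q'_ge0.
have mf : measurable_fun setT f by exact/measurable_EFinP/measurable_q'.
rewrite -(@ge0_integral_image _ _ _ _ _ beta _ mprs (image_measure beta mprs) f)//.
(* The marginal of [beta] has density [ws], and [ws * q' ws] is [q ws]. *)
by rewrite (@ge0_integral_density _ _ _ _ nus ws).
Qed.

Let beta_qE : \int[nut]_u (q (wt u))%:E =
  \int[beta]_z (q (wt (prt z)))%:E + \int[gapt]_u (q (wt u))%:E.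
Proof.
pose f u : \bar R := (q (wt u))%:E.
have f0 s : 0 <= f s by rewrite lee_fin q_ge0.
have mf : measurable_fun setT f by exact/measurable_EFinP/measurable_q.
rewrite (@ge0_integral_measureD _ _ _ nut (image_measure beta mprt) gapt f)//.
by congr (_ + _); exact: ge0_integral_image.
Qed.

Let mqs : measurable_fun setT (fun z => q' (ws (prs z))).
Proof. by apply: measurable_q' => //; exact: measurableT_comp. Qed.

Let mqt : measurable_fun setT (fun z => q (wt (prt z))).
Proof. by apply: measurable_q => //; exact: measurableT_comp. Qed.

Let ae_qq : {ae beta, forall z, (q' (ws (prs z)) <= q (wt (prt z)))%R}.
Proof. by apply: filterS beta_ge1 => z; exact: q'_le_q. Qed.

Let le_qq : \int[beta]_z (q' (ws (prs z)))%:E <= \int[beta]_z (q (wt (prt z)))%:E.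
Proof.
apply: ae_ge0_le_integral => //.
- by move=> z _; rewrite lee_fin q'_ge0.
- exact/measurable_EFinP.
- by move=> z _; rewrite lee_fin q_ge0.
- exact/measurable_EFinP.
- by apply: filterS ae_qq => z zq _; rewrite lee_fin.
Qed.

(** This precedes the hypothesis [value_eq] on purpose: used for two trades in opposite directions,
    it is what establishes that equality. *)
Lemma trade_value_le :
  \int[nus]_s (ws s / (1 + ws s))%:E <= \int[nut]_u (wt u / (1 + wt u))%:E.
Proof.
rewrite [leLHS]beta_q'E [leRHS]beta_qE; apply: le_trans le_qq _.
by rewrite leeDl// integral_ge0// => u _; rewrite lee_fin q_ge0.
Qed.

Hypothesis value_eq :
  \int[nus]_s (ws s / (1 + ws s))%:E = \int[nut]_u (wt u / (1 + wt u))%:E.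

(** Equal values leave no slack in either inequality behind [trade_value_le]. The cancellation is
    legitimate because [q] is bounded by 1 and [beta] is finite. *)
Let value_finE : \int[beta]_z (q' (ws (prs z)))%:E = \int[beta]_z (q (wt (prt z)))%:E /\
  \int[gapt]_u (q (wt u))%:E = 0.
Proof.
have bfin : \int[beta]_z (q (wt (prt z)))%:E \is a fin_num.
  rewrite ge0_fin_numE; last by apply: integral_ge0 => z _; rewrite lee_fin q_ge0.
  by apply: fin_q => //; exact: measurableT_comp.
have := value_eq; rewrite [X in X = _]beta_q'E [X in _ = X]beta_qE => veq.
have g0 : 0 <= \int[gapt]_u (q (wt u))%:E.
  by apply: integral_ge0 => z _; rewrite lee_fin q_ge0.
have gz : \int[gapt]_u (q (wt u))%:E = 0.
  apply/eqP; rewrite eq_le g0 andbT.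
  by have := le_qq; rewrite veq -[leRHS]adde0 leeD2lE.
by move: veq; rewrite gz adde0.
Qed.

Lemma trade_eq1 : {ae beta, forall z, (ws (prs z) * wt (prt z) = 1)%R}.
Proof.
have [+ _] := value_finE => eqq.
have : {ae beta, forall z, q' (ws (prs z)) = q (wt (prt z))}.
  apply: ae_eq_of_eq_integral => //.
  - by move=> z; exact: q'_ge0.
  - by move=> z; exact: q_ge0.
  - by apply: fin_q => //; exact: measurableT_comp.
by apply: filterS => z; exact: q'_eq_q.
Qed.

Lemma gap_carrier : {ae gapt, forall u, wt u = 0%R}.
Proof.
have [_ gz] := value_finE.
have := ge0_ae_eq0 measurableT _ _ gz.
have mq : measurable_fun setT (fun u => (q (wt u))%:E) by exact/measurable_EFinP/measurable_q.
move=> /(_ mq) H.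
have := H (fun u => q_ge0 (wt0 u)).
apply: filterS => u /(_ I)/= [] /eqP.
by rewrite /q mulf_eq0 invr_eq0 => /orP[/eqP//|]; rewrite gt_eqF// ltr_wpDr.
Qed.

End trade.

Section weighted_measure.
Context d (T : measurableType d) (R : realType).
Variables (mu : {finite_measure set T -> \bar R}) (phi : T -> R).
Hypotheses (mphi : measurable_fun setT phi) (phi0 : forall x, (0 <= phi x)%R).
Hypothesis phi1 : forall x, (phi x <= 1)%R.

(** The properties of [phi] are arguments so that the structure of a finite measure can be inferred;
    the bound by 1 gives domination by [mu]. *)
Definition weighted of measurable_fun setT phi & (forall x, (0 <= phi x)%R) &
  (forall x, (phi x <= 1)%R) := fun A => \int[mu]_(x in A) (phi x)%:E.

Local Notation wmu := (weighted mphi phi0 phi1).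

Let wmu0 : wmu set0 = 0.
Proof. exact: integral_set0. Qed.

Let wmu_ge0 A : 0 <= wmu A.
Proof. by apply: integral_ge0 => x _; rewrite lee_fin. Qed.

Let wmu_sigma_additive : semi_sigma_additive wmu.
Proof.
apply: semi_sigma_additive_nng_induced; first exact/measurable_EFinP.
by move=> x; rewrite lee_fin.
Qed.

HB.instance Definition _ := isMeasure.Build _ _ _ wmu
  wmu0 wmu_ge0 wmu_sigma_additive.

Lemma weighted_le A : measurable A -> wmu A <= mu A.
Proof.
move=> mA; rewrite -[leRHS]mul1e -(integral_cst mu mA); apply: ge0_le_integral => //.
- by move=> x _; rewrite lee_fin.
- by apply: measurable_funTS; exact/measurable_EFinP.
- by move=> x _; rewrite lee_fin.
Qed.

Let fin_wmu : fin_num_fun wmu.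
Proof.
move=> A mA; rewrite ge0_fin_numE// (le_lt_trans (weighted_le mA))//.
by rewrite ltey_eq fin_num_measure.
Qed.

HB.instance Definition _ := @Measure_isFinite.Build _ _ _ wmu fin_wmu.

End weighted_measure.

Lemma ae_le_measure d (T : measurableType d) (R : realType)
    (mu : {measure set T -> \bar R}) (A B : set T) :
  measurable A -> measurable B -> {ae mu, forall x, A x -> B x} -> mu A <= mu B.
Proof.
move=> mA mB [N [mN N0 ABN]].
apply: (@le_trans _ _ (mu (B `|` N))).
  rewrite le_measure ?inE//; first exact: measurableU.
  move=> x Ax; have [Bx|nBx] := pselect (B x); [by left|right].
  by apply: ABN => /(_ Ax).
by apply: le_trans (measureU2 _ _ _) _ => //; rewrite [X in _ + X]N0 adde0.
Qed.

(** * Computing [Fit] from reciprocal utilities *)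

Section level_optimal.
Context dZ dS dU (Z : measurableType dZ) (S : measurableType dS)
  (U : measurableType dU) (R : realType).
Variables (E : set Z) (prs : Z -> S) (prt : Z -> U).
Hypotheses (mprs : measurable_fun setT prs) (mprt : measurable_fun setT prt).
Hypothesis mEC : measurable (~` E).
Variables (nus gaps : {finite_measure set S -> \bar R})
  (nut : {finite_measure set U -> \bar R}).
Variables (ws : S -> R) (wt : U -> R) (alpha : {finite_measure set Z -> \bar R}).
Hypotheses (mws : measurable_fun setT ws) (mwt : measurable_fun setT wt).
Hypotheses (ws0 : forall s, (0 <= ws s)%R) (wt0 : forall u, (0 <= wt u)%R).
Hypothesis alpha_t : forall B, measurable B ->
  alpha (prt @^-1` B) = \int[nut]_(u in B) (wt u)%:E.
Hypothesis alpha_s : forall A, measurable A ->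
  nus A = alpha (prs @^-1` A) + gaps A.
Hypothesis alphaE : alpha (~` E) = 0.
Hypothesis alpha_eq1 : {ae alpha, forall z, (ws (prs z) * wt (prt z) = 1)%R}.
Hypothesis gaps_ws0 : {ae gaps, forall s, ws s = 0%R}.
Hypothesis feas_ge1 : forall (sigma : {finite_measure set Z -> \bar R}) (t : R),
  Feas E prs prt nus nut t sigma ->
  {ae sigma, forall z, (1 <= ws (prs z) * wt (prt z))%R}.

Let mpret B : measurable B -> measurable (prt @^-1` B).
Proof. by move=> mB; have := mprt measurableT mB; rewrite setTI. Qed.

Let mpres A : measurable A -> measurable (prs @^-1` A).
Proof. by move=> mA; have := mprs measurableT mA; rewrite setTI. Qed.

Let mle (f : U -> R) (t : R) : measurable_fun setT f -> measurable [set u | (f u <= t)%R].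
Proof.
move=> mf; rewrite (_ : [set u | _] = setT `&` f @^-1` `]-oo, t]%classic).
  exact: mf.
by rewrite setTI; apply/seteqP; split=> u /=; rewrite in_itv.
Qed.

Let mge (f : S -> R) (t : R) : measurable_fun setT f -> measurable [set s | (t <= f s)%R].
Proof.
move=> mf; rewrite (_ : [set u | _] = setT `&` f @^-1` `[t, +oo[%classic).
  exact: mf.
by rewrite setTI; apply/seteqP; split=> u /=; rewrite in_itv/= andbT.
Qed.

Let mmin (t : R) : measurable_fun setT (fun u => (Order.min (wt u) t)%:E).
Proof. by apply/measurable_EFinP; exact: measurable_minr. Qed.

Let min0 (t : R) u : (0 < t)%R -> 0 <= (Order.min (wt u) t)%:E.
Proof. by move=> t0; rewrite lee_fin le_min wt0 ltW. Qed.

Let Fit_le (sigma : {finite_measure set Z -> \bar R}) (t : R) : (0 < t)%R ->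
  Feas E prs prt nus nut t sigma ->
  sigma setT <= \int[nut]_u (Order.min (wt u) t)%:E.
Proof.
move=> t0 sF; have [sE ss st] := sF.
(* If [wt <= t] and [ws * wt >= 1], then [ws >= 1 / t]: what [sigma] sends into [lo] comes from [C].
   Above level [t] the capacity bound of [Feas] suffices. *)
pose lo := [set u | (wt u <= t)%R]; pose C := [set s | (t^-1 <= ws s)%R].
have mlo : measurable lo by exact: mle.
have mC : measurable C by exact: mge.
have -> : sigma setT = sigma (prt @^-1` lo) + sigma (prt @^-1` (~` lo)).
  rewrite -measureU//; [|exact: mpret|by apply: mpret; exact: measurableC|].
    by rewrite -preimage_setU setUCr.
  by rewrite -preimage_setI setICr.
have -> : \int[nut]_u (Order.min (wt u) t)%:E =
    \int[nut]_(u in lo) (wt u)%:E + t%:E * nut (~` lo).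
  rewrite -(setUCr lo) ge0_integral_setU//; last 4 first.
  - exact: measurableC.
  - by rewrite setUCr; exact: mmin.
  - by move=> u _; exact: min0.
  - by apply/disj_setPS; rewrite setICr.
  congr (_ + _).
    by apply: eq_integral => u /[1!inE] ut; rewrite min_l.
  rewrite -(integral_cst nut (measurableC mlo)); apply: eq_integral => u /[1!inE] /= /negP.
  by rewrite -ltNge => /ltW tu; rewrite min_r.
apply: leeD; last by apply: st; exact: measurableC.
apply: (@le_trans _ _ (sigma (prs @^-1` C))).
  apply: ae_le_measure; [exact: mpret|exact: mpres|].
  apply: filterS (feas_ge1 sF) => z ge1 /= wt_t.
  rewrite /C /= -div1r ler_pdivrMr//; apply: le_trans ge1 _.
  by rewrite ler_wpM2l.
apply: (@le_trans _ _ (nus C)); first exact: ss.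
(* The gap lives where [ws = 0], which is outside [C] because [1 / t > 0]; so all of [C] is
   accounted for by [alpha]. *)
have gC0 : gaps C = 0.
  apply: (@measure_negligible _ _ _ gaps) => //.
  move: gaps_ws0 => [N [mN N0 sN]]; exists N; split => // s /= Cs.
  apply: sN => /= ws_0; by move: Cs; rewrite /C /= ws_0 leNgt invr_gt0 t0.
rewrite alpha_s// gC0 adde0 -alpha_t//.
apply: ae_le_measure; [exact: mpres|exact: mpret|].
(* Along [alpha] the product is exactly one, so [ws >= 1 / t] forces [wt <= t]: the mass over [C]
   returns to [lo]. *)
apply: filterS alpha_eq1 => z eq1 /= Cz.
have : (t^-1 * wt (prt z) <= 1)%R by rewrite -eq1 ler_wpM2r.
by rewrite mulrC ler_pdivrMr// mul1r.
Qed.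

Let le_Fit (t : R) : (0 < t)%R ->
  \int[nut]_u (Order.min (wt u) t)%:E <= Fit E prs prt nus nut t.
Proof.
move=> t0.
(* This is the weight [min (1, t / wt u)], written so that the denominator is positive even where
   [wt] vanishes. It turns the density [wt] into [min (wt, t)]. *)
pose phi u : R := (t / Num.max t (wt u))%R.
have mx0 u : (0 < Num.max t (wt u))%R by rewrite lt_max t0.
have mphi : measurable_fun setT phi.
  apply: measurable_funM => //; apply: measurable_fun_invr => //.
  exact: measurable_maxr.
have phi0 u : (0 <= phi u)%R by rewrite divr_ge0// ltW.
have phi1 u : (phi u <= 1)%R by rewrite ler_pdivrMr// mul1r le_max lexx.
have wphi u : (wt u * phi u = Order.min (wt u) t)%R.
  rewrite /phi; have [ut|tu] := leP (wt u) t.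
    by rewrite divff ?mulr1// gt_eqF.
  by rewrite mulrCA divff ?mulr1// gt_eqF// (lt_trans t0).
have mphiz : measurable_fun setT (phi \o prt) by exact: measurableT_comp.
pose sigma : {finite_measure set Z -> \bar R} :=
  weighted alpha mphiz (fun z => phi0 (prt z)) (fun z => phi1 (prt z)).
have sigmaE B : measurable B -> sigma (prt @^-1` B) =
    \int[nut]_(u in B) (Order.min (wt u) t)%:E.
  move=> mB; pose f := (EFin \o phi) \_ B.
  have f0 u : 0 <= f u by rewrite /f patchE; case: ifPn => _; rewrite ?lee_fin.
  have mf : measurable_fun setT f.
    apply/(measurable_restrictT _ mB); apply: measurable_funTS.
    exact/measurable_EFinP.
  have -> : sigma (prt @^-1` B) = \int[alpha]_z f (prt z).
    rewrite /sigma/= /weighted integral_mkcond; apply: eq_integral => z _.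
    by rewrite /f !patchE; congr (if _ then _ else _); rewrite !inE.
  rewrite -(@ge0_integral_image _ _ _ _ _ alpha _ mprt (image_measure alpha mprt) f)//.
  rewrite (@ge0_integral_density _ _ _ _ nut wt)// [RHS]integral_mkcond.
  apply: eq_integral => u _; rewrite /f !patchE; case: ifPn => _; last by rewrite mule0.
  by rewrite /= -wphi.
rewrite -sigmaE//; apply: ereal_sup_ubound; exists sigma; last by rewrite preimage_setT.
have sle A : measurable A -> sigma A <= alpha A by exact: weighted_le.
split.
- by apply/eqP; rewrite -measure_le0 -alphaE sle.
- move=> A mA; apply: (@le_trans _ _ (alpha (prs @^-1` A))); first by apply: sle; exact: mpres.
  by rewrite alpha_s// leeDl.
- move=> B mB; rewrite [leLHS]sigmaE// -(integral_cst nut mB).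
  apply: ge0_le_integral => //.
  + by move=> u _; exact: min0.
  + exact: measurable_funTS.
  + by move=> u _; rewrite lee_fin ge_min lexx orbT.
Qed.

(** The marginal of [fill] is carried by the null set [Nt], hence is the singular part, while
    [alpha] contributes the part with density [wt]. *)
Lemma level_optimal_maximin_trade (pi fill : {finite_measure set Z -> \bar R}) (Nt : set U) :
  measurable Nt -> nut Nt = 0 -> fill (prt @^-1` (~` Nt)) = 0 ->
  (forall C, measurable C -> pi C = alpha C + fill C) ->
  level_optimal_maximin E prs prt nus nut pi.
Proof.
move=> mN N0 fillN piE.
exists wt, (image_measure alpha mprt), (image_measure fill mprt); split.
- split.
  + by move=> A mA; rewrite /pushforward piE//; exact: mpret.
  + apply/null_content_dominatesP => B mB B0.
    rewrite /= /image_measure /pushforward alpha_t//.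
    rewrite integral_mkcond; apply/eqP; rewrite eq_le integral_ge0 ?andbT; last first.
      by move=> u _; rewrite patchE; case: ifPn => _; rewrite ?lee_fin.
    rewrite -integral_mkcond.
    have /eqP <- : \int[nut]_(u in B) `|(wt u)%:E| == 0.
      by apply/eqP; apply: integral_abs_eq0 => //; apply: measurable_funTS; exact/measurable_EFinP.
    by under [leRHS]eq_integral do rewrite gee0_abs ?lee_fin//.
  + by exists Nt; split.
- split => //.
- move=> t t0; apply/eqP; rewrite eq_le le_Fit//=.
  by apply: ge_ereal_sup => _ [sigma sF <-]; exact: Fit_le.
Qed.

End level_optimal.

(** * Two opposite trades force equality of values *)

Section level_optimal_of_trades.
Context dZ dS dU (Z : measurableType dZ) (S : measurableType dS)
  (U : measurableType dU) (R : realType).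
Variables (E : set Z) (prs : Z -> S) (prt : Z -> U).
Hypotheses (mprs : measurable_fun setT prs) (mprt : measurable_fun setT prt).
Hypothesis mEC : measurable (~` E).
Variables (nus gaps : {finite_measure set S -> \bar R})
  (nut gapt : {finite_measure set U -> \bar R}).
Variables (ws : S -> R) (wt : U -> R) (Ns : set S) (Nt : set U).
Variables alpha beta fill : {finite_measure set Z -> \bar R}.
Hypotheses (mws : measurable_fun setT ws) (mwt : measurable_fun setT wt).
Hypotheses (ws0 : forall s, (0 <= ws s)%R) (wt0 : forall u, (0 <= wt u)%R).
Hypotheses (mNs : measurable Ns) (Ns0 : nus Ns = 0).
Hypotheses (mNt : measurable Nt) (Nt0 : nut Nt = 0).
Hypothesis edge_ge1 : forall z, E z -> ~ Ns (prs z) -> ~ Nt (prt z) ->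
  (1 <= ws (prs z) * wt (prt z))%R.
Hypotheses (alphaE : alpha (~` E) = 0) (betaE : beta (~` E) = 0) (fillE : fill (~` E) = 0).
Hypothesis alpha_s : forall A, measurable A -> nus A = alpha (prs @^-1` A) + gaps A.
Hypothesis beta_t : forall B, measurable B -> nut B = beta (prt @^-1` B) + gapt B.
Hypothesis alpha_t : forall B, measurable B ->
  alpha (prt @^-1` B) = \int[nut]_(u in B) (wt u)%:E.
Hypothesis beta_s : forall A, measurable A ->
  beta (prs @^-1` A) = \int[nus]_(s in A) (ws s)%:E.
Hypothesis fill_s : forall A, measurable A -> fill (prs @^-1` A) = gaps A.

Let mpret B : measurable B -> measurable (prt @^-1` B).
Proof. by move=> mB; have := mprt measurableT mB; rewrite setTI. Qed.

Let mpres A : measurable A -> measurable (prs @^-1` A).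
Proof. by move=> mA; have := mprs measurableT mA; rewrite setTI. Qed.

Let ae_ge1 (sigma : {finite_measure set Z -> \bar R}) :
  sigma (~` E) = 0 -> sigma (prs @^-1` Ns) = 0 -> sigma (prt @^-1` Nt) = 0 ->
  {ae sigma, forall z, (1 <= ws (prs z) * wt (prt z))%R}.
Proof.
move=> sE ss st; exists (~` E `|` (prs @^-1` Ns `|` prt @^-1` Nt)); split.
- by apply: measurableU => //; apply: measurableU; [exact: mpres|exact: mpret].
- apply/measure_negligible.
    by apply: measurableU => //; apply: measurableU; [exact: mpres|exact: mpret].
  apply: negligibleU; first exact/negligibleP.
  by apply: negligibleU; apply/negligibleP => //; [exact: mpres|exact: mpret].
- move=> z /= nge1; apply: contrapT => /not_orP[/contrapT Ez /not_orP[nNs nNt]].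
  exact/nge1/edge_ge1.
Qed.

Let null_integral dV (V : measurableType dV) (nu : {measure set V -> \bar R})
    (w : V -> R) (N : set V) :
  measurable_fun setT w -> (forall v, 0 <= w v)%R -> measurable N -> nu N = 0 ->
  \int[nu]_(v in N) (w v)%:E = 0.
Proof.
move=> mw w0 mN N0.
under eq_integral do rewrite -(gee0_abs (x := (w _)%:E)) ?lee_fin//.
by apply: integral_abs_eq0 => //; apply: measurable_funTS; exact/measurable_EFinP.
Qed.

Let alpha_ge1 : {ae alpha, forall z, (1 <= ws (prs z) * wt (prt z))%R}.
Proof.
apply: ae_ge1 => //.
- by apply/eqP; rewrite -measure_le0 -Ns0 alpha_s// leeDl.
- by rewrite alpha_t// null_integral.
Qed.

Let beta_ge1 : {ae beta, forall z, (1 <= ws (prs z) * wt (prt z))%R}.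
Proof.
apply: ae_ge1 => //.
- by rewrite beta_s// null_integral.
- by apply/eqP; rewrite -measure_le0 -Nt0 beta_t// leeDl.
Qed.

Let alpha_ge1C : {ae alpha, forall z, (1 <= wt (prt z) * ws (prs z))%R}.
Proof. by apply: filterS alpha_ge1 => z; rewrite mulrC. Qed.

(** [beta] bounds the value of side [S] by that of side [U], and [alpha] gives the reverse bound. *)
Let value_eq :
  \int[nus]_s (ws s / (1 + ws s))%:E = \int[nut]_u (wt u / (1 + wt u))%:E.
Proof.
apply/eqP; rewrite eq_le; apply/andP; split.
- exact: (trade_value_le mprs mprt mws mwt ws0 wt0 beta_s beta_t beta_ge1).
- exact: (trade_value_le mprt mprs mwt mws wt0 ws0 alpha_t alpha_s alpha_ge1C).
Qed.

Lemma level_optimal_of_trades (pi : {finite_measure set Z -> \bar R}) :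
  (forall C, measurable C -> pi C = alpha C + fill C) ->
  level_optimal_maximin E prs prt nus nut pi.
Proof.
have gap0 : {ae gaps, forall s, ws s = 0%R}.
  exact: (gap_carrier mprt mprs mwt mws wt0 ws0 alpha_t alpha_s alpha_ge1C (esym value_eq)).
have alpha1 : {ae alpha, forall z, (ws (prs z) * wt (prt z) = 1)%R}.
  have := trade_eq1 mprt mprs mwt mws wt0 ws0 alpha_t alpha_s alpha_ge1C (esym value_eq).
  by apply: filterS => z; rewrite mulrC.
apply: (@level_optimal_maximin_trade _ _ _ _ _ _ _ E prs prt _ _ _ nus gaps nut
  ws wt alpha _ _ _ _ _ _ _ _ _ _ pi fill Nt) => //.
(* The marginals of a feasible [sigma] are dominated by [nus] and by [t] times [nut], so [sigma]
   does not charge the exceptional sets. *)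
- move=> sigma t [sE ss st]; apply: ae_ge1 => //.
  + by apply/eqP; rewrite -measure_le0 -Ns0; exact: ss.
  + apply/eqP; rewrite -measure_le0; apply: le_trans (st _ mNt) _.
    by rewrite Nt0 mule0.
- (* An edge leaving an unmatched agent ends in the exceptional set, since
     there the product of the two utilities is zero. *)
  move: gap0 => [N [mN N0 wN]].
  apply/measure_negligible; first by apply: mpret; exact: measurableC.
  apply: (@negligibleS _ _ _ fill (~` E `|` (prs @^-1` Ns `|` prs @^-1` N))).
    move=> z /= nNt; apply: contrapT => /not_orP[/contrapT Ez /not_orP[nNs nN]].
    have := edge_ge1 Ez nNs nNt.
    suff -> : ws (prs z) = 0%R by rewrite mul0r ler10.
    by apply: contrapT => w0; exact/nN/wN.
  apply: negligibleU; first exact/negligibleP.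
  apply: negligibleU; apply/negligibleP; [exact: mpres| |exact: mpres|].
  + transitivity (gaps Ns); first exact: fill_s.
    by apply/eqP; rewrite -measure_le0 -Ns0 alpha_s// leeDr.
  + by transitivity (gaps N); first exact: fill_s.
Qed.

End level_optimal_of_trades.

(** * From equilibria to level-optimal refinements *)

Section walrasian_bounds.
Context d0 d1 (T0 : measurableType d0) (T1 : measurableType d1) (R : realType).
Variables (E : set (T0 * T1)) (nu0 : {finite_measure set T0 -> \bar R})
  (nu1 : {finite_measure set T1 -> \bar R}).

Local Notation T := (T0 + T1)%type.
Local Notation bundle := {finite_measure set T -> \bar R}.
Local Notation mu := (oplus nu0 nu1).

(** Neighborhoods are embedded in the sum so that agents of both sides are covered by one
    statement. *)
Definition neighbor (t : T) : set T :=
  match t with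
  | inl x => inr @` N1 E x
  | inr y => inl @` N0 E y
  end.

Lemma utilityE (t : T) (z : bundle) : utility E t z = z (neighbor t).
Proof. by case: t. Qed.

Lemma consumption_dirac (t t' : T) (c : {nonneg R}) : neighbor t t' ->
  consumption E t (mscale c \d_t' : bundle).
Proof.
case: t => [x|y] /= [v Ev <-]; split; rewrite /mscale/= diracE memNset ?mule0//.
- by case.
- by case=> v' nE [vv']; apply: nE; rewrite vv'.
- by case.
- by case=> v' nE [vv']; apply: nE; rewrite vv'.
Qed.

Lemma pairing_mscale_dirac (p : T -> R) (t : T) (c : {nonneg R}) :
  measurable_fun setT p -> (forall t, 0 <= p t)%R ->
  pairing p (mscale c \d_t) = (c%:num * p t)%:E.
Proof.
move=> mp p0; rewrite /pairing ge0_integral_mscale//.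
- by rewrite integral_dirac ?diracT ?mul1e//; exact/measurable_EFinP.
- exact/measurable_EFinP.
- by move=> s _; rewrite lee_fin.
Qed.

Lemma optimal_bundle_bound (p : T -> R) (t : T) (z : bundle) (w : R) :
  measurable_fun setT p -> (forall t, 0 <= p t)%R -> (0 <= w)%R ->
  utility E t z = w%:E ->
  ~ (exists z', budget E p t z' /\ utility E t z < utility E t z') ->
  forall t', neighbor t t' -> (0 < p t')%R /\ (p t <= w * p t')%R.
Proof.
move=> mp p0 w0 zw opt t' tt'.
have afford c : (0 <= c)%R -> (c * p t' <= p t)%R -> (c <= w)%R.
  move=> c0 cp; rewrite leNgt; apply/negP => wc; apply: opt.
  exists (mscale (NngNum c0) \d_t'); split.
    split; first exact: consumption_dirac.
    rewrite pairing_mscale_dirac// /pairing /endowment.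
    rewrite integral_dirac ?diracT ?mul1e ?lee_fin//.
    exact/measurable_EFinP.
  by rewrite zw utilityE [ltRHS](_ : _ = (c%:E * \d_t' (neighbor t))%E)//
    diracE mem_set// mule1 lte_fin.
have pt' : (0 < p t')%R.
  rewrite lt_neqAle p0 andbT eq_sym; apply/eqP => pt0.
  (* A free neighbor could be bought in the quantity [w + 1], which beats the optimal utility. *)
  have := afford (w + 1)%R; rewrite pt0 mulr0 => /(_ _ (p0 t)).
  have w1 : (0 <= w + 1)%R by rewrite addr_ge0.
  by move=> /(_ w1); rewrite gerDl ler10.
split => //.
(* The quantity [p t / p t'] exhausts the income of [t]. *)
rewrite -ler_pdivrMr//; apply: afford; first by rewrite divr_ge0.
by rewrite divfK// gt_eqF.
Qed.

Lemma ae_integrable_indic_value (a : T -> bundle) (C : set T) : measurable C ->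
  (forall q, bounded_measurable q -> ae_integrable nu0 nu1 (fun t => pairing q (a t))) ->
  exists g : T -> \bar R, measurable_fun setT g /\ {ae mu, forall t, a t C = g t}.
Proof.
move=> mC /(_ \1_C)[|g [ig gE]].
  split; first exact: measurable_indic.
  by exists 1%R => t; rewrite indicE; case: (_ \in _); rewrite ?normr1 ?normr0.
exists g; split; first exact: measurable_int ig.
apply: filterS gE => t <-.
by rewrite /pairing integral_indic// setIT.
Qed.

(** The neighborhood varies with the agent, so the utility is not a pairing with one fixed function.
    By the consumption constraint it equals the mass of the whole opposite side, which is such a
    pairing and so agrees almost everywhere with a measurable function. *)
Lemma walrasian_utility (a : T -> bundle) (p : T -> R) :
  (forall x, measurable (N1 E x)) -> (forall y, measurable (N0 E y)) ->
  walrasian_equilibrium E nu0 nu1 a p ->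
  exists (w : T -> R) (N : set T),
    [/\ measurable_fun setT w, (forall t, 0 <= w t)%R, measurable N, mu N = 0 &
        forall t, ~ N t -> (w t)%:E = a t (neighbor t) /\
          forall t', neighbor t t' -> (0 < p t')%R /\ (p t <= w t * p t')%R].
Proof.
move=> mN1 mN0 [[mp _] p0 _ [[cons int _] _] opt].
have [g1 [mg1 g1E]] := ae_integrable_indic_value (measurable_image_inr T0 measurableT) int.
have [g0 [mg0 g0E]] := ae_integrable_indic_value (measurable_image_inl T1 measurableT) int.
(* The maximum makes [w] nonnegative everywhere; it changes nothing where [g1] or [g0] is the mass
   of a finite measure. *)
pose w (t : T) : R := match t with
  | inl x => Num.max 0%R (fine (g1 (inl x)))
  | inr y => Num.max 0%R (fine (g0 (inr y)))
  end.
have mw : measurable_fun setT w.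
  apply: measurable_fun_sumtype; apply: measurable_maxr => //;
    (apply: (@measurableT_comp _ _ _ _ _ _ fine) => //; apply: measurableT_comp => //).
  - exact: measurable_inl.
  - exact: measurable_inr.
have w0 t : (0 <= w t)%R by case: t => t; rewrite /w le_max lexx.
suff [N [mN N0 wN]] : {ae mu, forall t, (w t)%:E = a t (neighbor t) /\
    forall t', neighbor t t' -> (0 < p t')%R /\ (p t <= w t * p t')%R}.
  by exists w, N; split => // t nNt; apply: contrapT => /wN.
apply: filterS (filterI cons (filterI g1E (filterI g0E opt))).
move=> t [ct [g1t [g0t [[_ _] optt]]]].
have wt : (w t)%:E = a t (neighbor t).
  have fin C : measurable C -> a t C = (Num.max 0%R (fine (a t C)))%:E.
    by move=> mC; rewrite max_r ?fineK ?fine_ge0//; exact: fin_num_measure.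
  case: t ct g1t g0t {optt} fin => [x|y] /= [_ c0] g1t g0t fin.
  - rewrite -g1t -fin; last exact: measurable_image_inr.
    rewrite -(setUCr (N1 E x)) image_setU measureU.
    + by rewrite [X in _ + X]c0 adde0.
    + exact: measurable_image_inr.
    + by apply: measurable_image_inr; exact: measurableC.
    + by rewrite -subset0 => _ [[u Nu <-] [v nNv [vu]]]; apply: nNv; rewrite vu.
  - rewrite -g0t -fin; last exact: measurable_image_inl.
    rewrite -(setUCr (N0 E y)) image_setU measureU.
    + by rewrite [X in _ + X]c0 adde0.
    + exact: measurable_image_inl.
    + by apply: measurable_image_inl; exact: measurableC.
    + by rewrite -subset0 => _ [[u Nu <-] [v nNv [vu]]]; apply: nNv; rewrite vu.
split=> // t' tt'; apply: optimal_bundle_bound optt _ tt' => //.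
by rewrite utilityE.
Qed.

End walrasian_bounds.

(** * The pair extracted from an equilibrium allocation *)

Section extracted.
Context d0 d1 (T0 : measurableType d0) (T1 : measurableType d1) (R : realType).
Variables (E : set (T0 * T1)) (nu0 : {finite_measure set T0 -> \bar R})
  (nu1 : {finite_measure set T1 -> \bar R}).
Variables (F : nat -> set T0) (G : nat -> set T1).
Hypotheses (mF : forall i, measurable (F i)) (mG : forall i, measurable (G i)).
Hypothesis EC : forall x y, ~ E (x, y) <-> exists i, F i x /\ G i y.

Local Notation T := (T0 + T1)%type.
Local Notation bundle := {finite_measure set T -> \bar R}.

Let EC' (y : T1) (x : T0) : ~ N0 E y x <-> exists i, G i y /\ F i x.
Proof. by rewrite /N0 /= EC; split=> -[i []]; exists i. Qed.

Let edge1 (z : T0 * T1) : E z <-> N1 E z.1 z.2.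
Proof. by case: z. Qed.

Let edge0 (z : T0 * T1) : E z <-> N0 E z.2 z.1.
Proof. by case: z. Qed.

Lemma measurable_N1 x : measurable (N1 E x).
Proof. exact: (measurable_neighborhood mG (fun x y => EC x y)). Qed.

Lemma measurable_N0 y : measurable (N0 E y).
Proof. exact: (measurable_neighborhood mF EC'). Qed.

Lemma measurable_edge : measurable (~` E).
Proof. exact: (measurable_edgeC measurable_fst measurable_snd edge1 mF mG (fun x y => EC x y)). Qed.

Lemma extracted_level_optimal (a : T -> bundle) (p : T -> R)
    (pi0 pi1 : {finite_measure set (T0 * T1)%type -> \bar R}) :
  walrasian_equilibrium E nu0 nu1 a p -> extracted_pair E nu0 nu1 pi0 pi1 a ->
  [/\ refinement E fst nu0 pi0, refinement E snd nu1 pi1,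
      level_optimal_maximin E fst snd nu0 nu1 pi0 &
      level_optimal_maximin E snd fst nu1 nu0 pi1].
Proof.
move=> eq [G0 [G1 [tpi0 [tpi1 [gap0 [gap1 [fill0 [fill1]]]]]]]].
move=> [[G0N G1N] [tpi0E tpi1E] [nu0E nu1E] [fill0E fill1E] [pi0E pi1E]].
have [w [N [mw w0 mN N0 wN]]] := walrasian_utility measurable_N1 measurable_N0 eq.
have mN_0 : measurable (inl @^-1` N : set T0) by case: mN.
have mN_1 : measurable (inr @^-1` N : set T1) by case: mN.
have [nu0N nu1N] : nu0 (inl @^-1` N) = 0 /\ nu1 (inr @^-1` N) = 0.
  by move/eqP: N0; rewrite /oplus padde_eq0// => /andP[/eqP -> /eqP ->].
have mw0 : measurable_fun setT (w \o inl) by apply: measurableT_comp => //; exact: measurable_inl.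
have mw1 : measurable_fun setT (w \o inr) by apply: measurableT_comp => //; exact: measurable_inr.
have probC d d' (X : measurableType d) (Y : measurableType d') (K : R.-pker X ~> Y) x (C : set Y) :
    measurable C -> K x C = 1 -> K x (~` C) = 0.
  move=> mC KC; have KT : K x setT = 1 by exact: prob_kernel.
  have : K x setT = K x C + K x (~` C).
    by rewrite -measureU ?setICr// ?setUCr//; exact: measurableC.
  by rewrite KT KC => /(congr1 (fun e => e - 1)); rewrite addeAC subee// add0e.
have edge_ge1 x y : E (x, y) -> ~ N (inl x) -> ~ N (inr y) ->
    (1 <= w (inl x) * w (inr y))%R.
  move=> Exy /wN[_ /(_ (inr y))] + /wN[_ /(_ (inl x))].
  move=> /(_ (ex_intro2 _ _ y Exy erefl))[py xy] /(_ (ex_intro2 _ _ x Exy erefl))[px yx].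
  (* The two price bounds are multiplied and the positive factor [p x * p y] is cancelled. *)
  have pxy : (0 < p (inl x) * p (inr y))%R by rewrite mulr_gt0.
  rewrite -(ler_pM2r pxy) mul1r.
  apply: (@le_trans _ _ ((w (inl x) * p (inr y)) * (w (inr y) * p (inl x)))%R); last lra.
  by rewrite ler_pM// ltW.
have tpi0C : tpi0 (~` E) = 0.
  apply: (null_edgeC measurable_fst measurable_snd edge1 mF mG (fun x y => EC x y)) => i.
  rewrite [LHS]tpi0E//; apply: integral0_eq => y Gy.
  rewrite (_ : F i `&` _ = set0) ?image_set0 ?measure0//.
  by rewrite -subset0 => x [Fx] /=; apply/EC; exists i.
have tpi1C : tpi1 (~` E) = 0.
  apply: (null_edgeC measurable_fst measurable_snd edge1 mF mG (fun x y => EC x y)) => i.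
  rewrite [LHS]tpi1E//; apply: integral0_eq => x Fx.
  rewrite (_ : G i `&` _ = set0) ?image_set0 ?measure0//.
  by rewrite -subset0 => y [Gy] /=; apply/EC; exists i.
have fill0C : fill0 (~` E) = 0.
  apply: (neighborhood_bowtie measurable_fst measurable_snd edge1 mF mG (fun x y => EC x y) fill0E).
  by move=> x; apply: probC; [exact: measurable_N1|exact: G0N].
have fill1C : fill1 (~` E) = 0.
  apply: (neighborhood_bowtie measurable_snd measurable_fst edge0 mG mF EC' fill1E).
  by move=> y; apply: probC; [exact: measurable_N0|exact: G1N].
have tpi1_fst A : measurable A ->
    tpi1 (fst @^-1` A) = \int[nu0]_(x in A) (w (inl x))%:E.
  (* The utility under the integral is known to equal the measurable [w] only off [N], so it may
     itself fail to be measurable. *)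
  move=> mA; rewrite -setXT tpi1E//; apply: ge0_ae_eq_integral_nonmeasurable => //.
  - by move=> x; rewrite lee_fin.
  - exact/measurable_EFinP.
  - exists (inl @^-1` N); split => // x /= xne; apply: contrapT => /wN[wx _].
    by apply: xne; rewrite wx setTI.
have tpi0_snd B : measurable B ->
    tpi0 (snd @^-1` B) = \int[nu1]_(y in B) (w (inr y))%:E.
  move=> mB; rewrite -setTX tpi0E//; apply: ge0_ae_eq_integral_nonmeasurable => //.
  - by move=> x; rewrite lee_fin.
  - exact/measurable_EFinP.
  - exists (inr @^-1` N); split => // x /= xne; apply: contrapT => /wN[wx _].
    by apply: xne; rewrite wx setTI.
have fill0_fst A : measurable A -> fill0 (fst @^-1` A) = gap0 A.
  move=> mA; have := fill0E A setT mA measurableT; rewrite preimage_setT setIT => ->.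
  under eq_integral do rewrite prob_kernel.
  by rewrite integral_cst// mul1e.
have fill1_snd B : measurable B -> fill1 (snd @^-1` B) = gap1 B.
  move=> mB; have := fill1E B setT mB measurableT; rewrite preimage_setT setIT => ->.
  under eq_integral do rewrite prob_kernel.
  by rewrite integral_cst// mul1e.
split.
- split; first by rewrite pi0E ?tpi0C ?fill0C ?adde0//; exact: measurable_edge.
  move=> A mA; rewrite /pushforward pi0E ?fill0_fst ?nu0E//.
  by rewrite -[X in measurable X]setTI; exact: measurable_fst.
- split; first by rewrite pi1E ?tpi1C ?fill1C ?adde0//; exact: measurable_edge.
  move=> B mB; rewrite /pushforward pi1E ?fill1_snd ?nu1E//.
  by rewrite -[X in measurable X]setTI; exact: measurable_snd.
(* [tpi0] records the purchases of side 1 and has density [w] there; [tpi1] is the opposite trade.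
   The next case exchanges their roles. *)
- apply: (@level_optimal_of_trades _ _ _ _ _ _ _ E fst snd measurable_fst measurable_snd
    measurable_edge nu0 gap0 nu1 gap1 (w \o inl) (w \o inr) (inl @^-1` N) (inr @^-1` N)
    tpi0 tpi1 fill0) => //; try by move=> ?; exact: w0.
  by move=> [x y] /=; exact: edge_ge1.
- apply: (@level_optimal_of_trades _ _ _ _ _ _ _ E snd fst measurable_snd measurable_fst
    measurable_edge nu1 gap1 nu0 gap0 (w \o inr) (w \o inl) (inr @^-1` N) (inl @^-1` N)
    tpi1 tpi0 fill1) => //; try by move=> ?; exact: w0.
  by move=> [x y] /= Exy Ny Nx; rewrite mulrC; exact: edge_ge1.
Qed.

End extracted.

(** * From refinements to equilibria *)

Section density_decomposition_theory.
Context d (T : measurableType d) (R : realType).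
Variables (P : set T -> \bar R) (nu : {finite_measure set T -> \bar R}).
Variable D : density_decomposition P nu.

Let nuE A : measurable A -> nu A = dd_nuac D A + dd_nuperp D A.
Proof. by case: (dd_nu_decomposition D) => + _ _ => /[apply]. Qed.

Let mSac := dd_Sac_measurable D.
Let mSperp := dd_Sperp_measurable D.

(** The singular part is carried by [dd_Sperp], which is disjoint from [dd_Sac]; so [dd_nuac] is a
    plain restriction of [nu]. *)
Lemma dd_nuacE A : measurable A -> dd_nuac D A = nu (A `&` dd_Sac D).
Proof.
move=> mA; have mAS : measurable (A `&` dd_Sac D) by exact: measurableI.
rewrite nuE// (_ : dd_nuperp D _ = 0) ?adde0.
  rewrite (measureDI (dd_nuac D) mA mSac) [X in X + _ = _](_ : _ = 0) ?add0e//.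
  apply/eqP; rewrite -measure_le0 -(dd_nuac_carrier D) le_measure ?inE//.
  - exact: measurableD.
  - exact: measurableC.
apply/eqP; rewrite -measure_le0 -(dd_nuperp_carrier D) le_measure ?inE//.
- exact: measurableC.
- move=> x [_ Sx] Sperpx; have : (dd_Sac D `&` dd_Sperp D) x by [].
  by rewrite dd_disjoint.
Qed.

Lemma dd_cover : {ae nu, forall x, dd_Sac D x \/ dd_Sperp D x}.
Proof.
have mC : measurable (~` (dd_Sac D `|` dd_Sperp D)).
  by apply: measurableC; exact: measurableU.
exists (~` (dd_Sac D `|` dd_Sperp D)); split => //.
rewrite nuE//; apply/eqP; rewrite padde_eq0//; apply/andP; split.
- rewrite -measure_le0 -(dd_nuac_carrier D) le_measure ?inE//.
    exact: measurableC.
  by apply: subsetC; exact: subsetUl.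
- rewrite -measure_le0 -(dd_nuperp_carrier D) le_measure ?inE//.
    exact: measurableC.
  by apply: subsetC; exact: subsetUr.
Qed.

Lemma dd_nuac_ae (Q : T -> Prop) : {ae dd_nuac D, forall x, Q x} ->
  {ae nu, forall x, dd_Sac D x -> Q x}.
Proof.
move=> [N [mN N0 QN]]; exists (N `&` dd_Sac D); split.
- exact: measurableI.
- by rewrite -dd_nuacE.
- by move=> x /= /not_implyP[Sx nQ]; split=> //; exact: QN.
Qed.

Lemma ge0_integral_dd_nuac A (f : T -> \bar R) : measurable A ->
  (forall x, 0 <= f x) -> measurable_fun setT f ->
  \int[dd_nuac D]_(x in A) f x = \int[nu]_(x in A `&` dd_Sac D) f x.
Proof. by move=> mA; apply: ge0_integral_carrier => // B; exact: dd_nuacE. Qed.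

End density_decomposition_theory.

(** * Support, marginal and mass of an exchange kernel *)

Section exchange.
Context dZ dS dU (Z : measurableType dZ) (S : measurableType dS)
  (U : measurableType dU) (R : realType).
Variables (E : set Z) (prs : Z -> S) (prt : Z -> U) (Nb : S -> set U).
Variables (F : nat -> set S) (V : nat -> set U).
Hypotheses (mprs : measurable_fun setT prs) (mprt : measurable_fun setT prt).
Hypothesis ENb : forall z, E z <-> Nb (prs z) (prt z).
Hypotheses (mF : forall i, measurable (F i)) (mV : forall i, measurable (V i)).
Hypothesis NbC : forall s u, ~ Nb s u <-> exists i, F i s /\ V i u.
Variables (nus : {finite_measure set S -> \bar R})
  (nut : {finite_measure set U -> \bar R}).
Variables (pi piac : {finite_measure set Z -> \bar R}) (P : set U -> \bar R).
Variables (DS : density_decomposition (pushforward pi prs) nus)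
  (DU : density_decomposition P nut).
Variables (K : R.-ftker S ~> U) (G : R.-pker U ~> S).
Hypothesis piE : pi (~` E) = 0.
Hypothesis pi_G : is_bowtie prt prs nut G pi.
Hypothesis piac_G : is_bowtie prt prs (dd_nuac DU) G piac.
Hypothesis piac_K : is_bowtie prs prt (dd_nuac DS) K piac.

Let mG A : measurable A -> measurable_fun setT (fun u => G u A).
Proof. exact: measurable_kernel. Qed.

Let mK B : measurable B -> measurable_fun setT (fun s => K s B).
Proof. exact: measurable_kernel. Qed.

Let ENb' z : E z <-> (fun u s => Nb s u) (prt z) (prs z).
Proof. exact: ENb. Qed.

Let NbC' u s : ~ Nb s u <-> exists i, V i u /\ F i s.
Proof. by rewrite NbC; split=> -[i []]; exists i. Qed.

Let piacE : piac (~` E) = 0.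
Proof.
apply: (null_edgeC mprt mprs ENb' mV mF NbC') => i.
apply/eqP; rewrite -measure_le0 -piE.
have mrect : measurable (prt @^-1` V i `&` prs @^-1` F i).
  apply: measurableI.
    by have := mprt measurableT (mV i); rewrite setTI.
  by have := mprs measurableT (mF i); rewrite setTI.
apply: (@le_trans _ _ (pi (prt @^-1` V i `&` prs @^-1` F i))).
  rewrite [leLHS](piac_G (mV i) (mF i)) [leRHS](pi_G (mV i) (mF i)).
  rewrite ge0_integral_dd_nuac//; last exact: mG.
  apply: ge0_subset_integral => //.
  - by apply: measurableI => //; exact: dd_Sac_measurable.
  - by apply: measurable_funTS; exact: mG.
rewrite le_measure ?inE//.
- exact: (measurable_edgeC mprs mprt ENb mF mV NbC).
- by rewrite (setC_edge ENb' NbC') => z; exists i.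
Qed.

Lemma exchange_neighborhood : {ae nus, forall s, dd_Sac DS s -> K s (~` Nb s) = 0}.
Proof.
apply: dd_nuac_ae.
exact: (bowtie_neighborhood mprs mprt ENb mF mV NbC mK piac_K piacE).
Qed.

(** Both sides are the [U]-marginal of [piac], computed once through [K] and once through the
    probability kernel [G]. *)
Lemma exchange_marginal B : measurable B ->
  \int[nus]_(s in dd_Sac DS) K s B = nut (B `&` dd_Sac DU).
Proof.
move=> mB; rewrite -dd_nuacE//.
have <- : piac (prt @^-1` B) = dd_nuac DU B.
  have := piac_G mB measurableT; rewrite preimage_setT setIT => ->.
  under eq_integral do rewrite prob_kernel.
  by rewrite integral_cst// mul1e.
have := piac_K measurableT mB; rewrite preimage_setT setTI => ->.
by rewrite ge0_integral_dd_nuac ?setTI//; exact: mK.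
Qed.

Variable Ms : set S.
Hypotheses (mMs : measurable Ms) (Ms0 : nus Ms = 0).
Hypothesis Sperp_Ms : forall u s, dd_Sperp DU u -> Nb s u -> Ms s.

(* Off [Ms] no edge leaves [dd_Sperp DU], so there [piac] has the same marginal
   as [pi], namely the density part of [pushforward pi prs]. *)
Let pi_piac A : measurable A -> (forall s, A s -> ~ Ms s) ->
  pi (prs @^-1` A) = piac (prs @^-1` A).
Proof.
move=> mA AMs.
have := pi_G measurableT mA; rewrite preimage_setT setTI => ->.
have := piac_G measurableT mA; rewrite preimage_setT setTI => ->.
rewrite ge0_integral_dd_nuac//; last exact: mG.
rewrite setTI [RHS]integral_mkcond; apply: ge0_ae_eq_integral => //.
- exact: mG.
- apply/(measurable_restrictT _ (dd_Sac_measurable DU)).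
  by apply: measurable_funTS; exact: mG.
- by move=> u _; rewrite patchE; case: ifPn.
- have GN := bowtie_neighborhood mprt mprs ENb' mV mF NbC' mG pi_G piE.
  apply: filterS2 GN (dd_cover DU) => u GN0 cov _.
  rewrite patchE; case: ifPn => // nS; rewrite notin_setE in nS.
  case: cov => // Sp; apply/eqP; rewrite -measure_le0 -GN0 le_measure ?inE//.
    exact: (measurable_neighborhoodC mF NbC').
  by move=> s As /= Nsu; exact/(AMs s As)/(Sperp_Ms Sp).
Qed.

(** On [dd_Sac] off [Ms] and off the carrier [N] of the singular part, the marginals of [pi] and
    [piac] coincide. One has density [dd_rho], the other [K s setT], and densities are unique almost
    everywhere. *)
Lemma exchange_mass : {ae nus, forall s, dd_Sac DS s -> K s setT = (dd_rho DS s)%:E}.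
Proof.
have [PE _ [N [mN N0 PN]]] := dd_P_decomposition DS.
have [mrho rho0 rhoE] := dd_rho_density DS.
pose A := dd_Sac DS `&` ~` (Ms `|` N).
have mA : measurable A.
  apply: measurableI; first exact: dd_Sac_measurable.
  by apply: measurableC; exact: measurableU.
have AE : {ae nus, forall s, A s -> (dd_rho DS s)%:E = K s setT}.
  apply: integral_ae_eq => //.
  - apply/integrableP; split.
      by apply: measurable_funTS; exact/measurable_EFinP.
    under eq_integral do rewrite gee0_abs ?lee_fin//.
    by rewrite -rhoE// ltey_eq fin_num_measure.
  - by apply: measurable_funTS; exact: mK.
  - move=> B BA mB; rewrite -rhoE//.
    have -> : dd_Pac DS B = pushforward pi prs B.
      rewrite PE// (_ : dd_Pperp DS B = 0) ?adde0//.
      apply/eqP; rewrite -measure_le0 -PN le_measure ?inE//.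
        exact: measurableC.
      by move=> s /BA[_ nMN] Ns; apply: nMN; right.
    rewrite /pushforward pi_piac//; last by move=> s /BA[_ nMN] Ms_s; apply: nMN; left.
    have := piac_K mB measurableT; rewrite preimage_setT setIT => ->.
    rewrite ge0_integral_dd_nuac//; last exact: mK.
    by congr (integral _ _ _); apply/setIidPl => s /BA[].
have off : {ae nus, forall s, ~ (Ms `|` N) s}.
  exists (Ms `|` N); split; first exact: measurableU.
    apply: measure_negligible; first exact: measurableU.
    by apply: negligibleU; exact/negligibleP.
  by move=> s /= /contrapT.
by apply: filterS2 AE off => s As offs Ss; rewrite As.
Qed.

End exchange.

(** [r] is the mass that [s] buys and [c] a lower bound for the price of each neighbor. A neighbor
    costs 2 or lies in [Uac] off [Mu], since [Uperp] cannot be reached from outside [Ms]. *)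
Lemma supporting_price (S U : Type) (R : realType) (Nb : S -> set U)
    (Sac Sperp Ms : set S) (rs ps : S -> R) (Uac Uperp Mu : set U) (rt pt : U -> R) :
  (forall s, (0 <= rs s)%R) -> (forall u, (0 <= rt u)%R) ->
  (forall s, ~ Ms s -> Sac s -> ps s = (rs s / (1 + rs s))%R) ->
  (forall s, ~ Ms s -> Sperp s -> ps s = 0%R) ->
  (forall u, Mu u \/ ~ (Uac u \/ Uperp u) -> pt u = 2%R) ->
  (forall u, ~ Mu u -> Uac u -> pt u = (rt u / (1 + rt u))%R) ->
  (forall s u, Nb s u -> Sac s -> (rs s * rt u < 1)%R -> Mu u) ->
  (forall s u, Nb s u -> Sperp s -> Mu u) ->
  (forall s u, Nb s u -> Uperp u -> Ms s) ->
  forall s r, ~ Ms s -> (Sac s /\ r = rs s) \/ (Sperp s /\ r = 0%R) ->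
    exists c : R, [/\ (0 < c)%R, ps s = (c * r)%R & forall u, Nb s u -> (c <= pt u)%R].
Proof.
move=> rs0 rt0 ps1 ps0 pt2 pt1 ac_ac perp_ac ac_perp s r nMs [[Ss ->]|[Ss ->]]; last first.
  (* An agent of [Sperp] has income zero, and all its neighbors lie in [Mu], where the price is
     2. *)
  exists 2%R; split => //; first by rewrite ps0// mulr0.
  by move=> u su; rewrite pt2//; left; exact: perp_ac su Ss.
have r1 : (0 < 1 + rs s)%R by rewrite ltr_wpDr.
exists (1 + rs s)^-1%R; split.
- by rewrite invr_gt0.
- by rewrite ps1// mulrC.
- move=> u su; have [Mu_u|nMu] := pselect (Mu u \/ ~ (Uac u \/ Uperp u)).
    rewrite pt2// (@le_trans _ _ 1%R)//; last by rewrite ler1n.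
    by rewrite invf_le1// lerDl.
  move/not_orP: nMu => [nMu /contrapT [Uu|Uu]]; last by case: nMs; exact: ac_perp su Uu.
  have r1r : (1 <= rs s * rt u)%R.
    by rewrite leNgt; apply/negP => lt1; apply: nMu; exact: ac_ac su Ss lt1.
  have rt1 : (0 < 1 + rt u)%R by rewrite ltr_wpDr.
  rewrite pt1// ler_pdivlMr// mulrC ler_pdivrMr//; lra.
Qed.

Lemma measurable_induced_price d (T : measurableType d) (R : realType)
    (Sac Sperp M : set T) (r p : T -> R) :
  measurable Sac -> measurable Sperp -> measurable M ->
  measurable_fun setT r -> (forall x, 0 <= r x)%R ->
  (forall x, [/\ M x \/ ~ (Sac x \/ Sperp x) -> p x = 2%R,
     ~ M x -> Sac x -> p x = (r x / (1 + r x))%R & ~ M x -> Sperp x -> p x = 0%R]) ->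
  measurable_fun setT p /\ forall x, (0 <= p x <= 2)%R.
Proof.
move=> mSac mSperp mM mr r0 pE.
have r1 x : (0 < 1 + r x)%R by rewrite ltr_wpDr.
pose A := M `|` ~` (Sac `|` Sperp).
have mA : measurable A by apply: measurableU => //; apply: measurableC; exact: measurableU.
have pI x : p x = (2 * \1_A x + r x / (1 + r x) * \1_(Sac `\` M) x)%R.
  have [p2 p1 p0] := pE x; rewrite !indicE.
  have [Ax|nAx] := pselect (A x).
    rewrite mem_set// memNset ?p2 ?mulr1 ?mulr0 ?addr0//.
    by case=> Sx nMx; case: Ax => // nS; apply: nS; left.
  rewrite memNset// mulr0 add0r; move/not_orP : nAx => [nMx /contrapT [Sx|Sx]].
    by rewrite mem_set// p1// mulr1.
  have [Sacx|nSacx] := pselect (Sac x); first by rewrite mem_set// p1// mulr1.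
  by rewrite memNset ?p0 ?mulr0// => -[].
have mq : measurable_fun setT (fun x => r x / (1 + r x))%R.
  by apply: measurable_funM => //; apply: measurable_fun_invr => //; exact: measurable_funD.
split.
  rewrite (funext pI); apply: measurable_funD; apply: measurable_funM => //.
  by apply: measurable_indic; exact: measurableD.
move=> x; have [p2 p1 p0] := pE x.
have [Mx|nMx] := pselect (M x); first by rewrite p2 ?ler0n ?lexx//; left.
have [Sx|nSx] := pselect (Sac x).
  rewrite p1//; apply/andP; split; first by rewrite divr_ge0// ltW.
  by rewrite ler_pdivrMr//; have := r0 x; lra.
have [Sx|nSpx] := pselect (Sperp x); first by rewrite p0// lexx ler0n.
by rewrite p2 ?ler0n ?lexx//; right => -[].
Qed.

Lemma pairing_ge d0 d1 (T0 : measurableType d0) (T1 : measurableType d1) (R : realType)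
    (p : T0 + T1 -> R) (z : {measure set (T0 + T1)%type -> \bar R}) (C : set (T0 + T1)) (c : R) :
  measurable_fun setT p -> (forall t, 0 <= p t)%R -> measurable C ->
  (forall t, C t -> c <= p t)%R -> (0 <= c)%R -> c%:E * z C <= pairing p z.
Proof.
move=> mp p0 mC cp c0; rewrite -(integral_cst z mC) /pairing.
apply: (@le_trans _ _ (\int[z]_(t in C) (p t)%:E)).
  apply: ge0_le_integral => //; first by apply: measurable_funTS; exact/measurable_EFinP.
apply: ge0_subset_integral => //.
- exact/measurable_EFinP.
- by move=> t _; rewrite lee_fin.
Qed.

Lemma signed_integral_measure d0 d1 (T0 : measurableType d0) (T1 : measurableType d1)
    (R : realType) (m : {finite_measure set (T0 + T1)%type -> \bar R}) (q : T0 + T1 -> R) :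
  signed_integral (charge_of_finite_measure m) q (\int[m]_t (q t)%:E).
Proof.
(* For a nonnegative measure the whole space is a positive set, so the negative part vanishes. *)
have mT : hahn_decomposition (charge_of_finite_measure m) setT set0.
  split; [split=> //|split=> //|exact: setU0|exact: setI0].
  by move=> A mA; rewrite subset0 => ->; rewrite charge0.
exists setT, set0, mT.
have -> : \int[jordan_pos mT]_t (q t)%:E = \int[m]_t (q t)%:E.
  apply: eq_measure_integral => A mA _.
  rewrite [LHS]jordan_posE cjordan_posE /crestr0 mem_set// /crestr setIT.
  by [].
have -> : \int[jordan_neg mT]_t (q t)%:E = 0.
  rewrite -(integral_measure_zero setT (fun t => (q t)%:E)).
  apply: eq_measure_integral => A mA _.
  by rewrite [LHS]jordan_negE cjordan_negE /crestr0 mem_set// /crestr setI0 charge0 oppe0.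
by rewrite sube0.
Qed.

(** * Allocations that redistribute the endowment measure *)

Section measure_preserving_kernel.
Context d0 d1 (T0 : measurableType d0) (T1 : measurableType d1) (R : realType).
Variables (nu0 : {finite_measure set T0 -> \bar R}) (nu1 : {finite_measure set T1 -> \bar R}).

Local Notation T := (T0 + T1)%type.
Local Notation bundle := {finite_measure set T -> \bar R}.
Local Notation mu := (oplus nu0 nu1).

Variable a : T -> bundle.
Hypothesis ma : forall B, measurable B -> measurable_fun setT (fun t => a t B).
Hypothesis aE : forall B, measurable B -> \int[mu]_t a t B = mu B.

Let integral_a (f : T -> \bar R) : (forall t, 0 <= f t) -> measurable_fun setT f ->
  \int[mu]_t f t = \int[mu]_t \int[a t]_s f s.
Proof.
move=> f0 mf.
apply: (@ge0_integral_mixture _ _ _ _ _ mu mu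
  (fun t => a t : {measure set T -> \bar R})) => //.
by move=> B mB; rewrite aE.
Qed.

Let measurable_integral_a (f : T -> \bar R) : (forall t, 0 <= f t) -> measurable_fun setT f ->
  measurable_fun setT (fun t => \int[a t]_s f s).
Proof.
move=> f0 mf.
exact: (@measurable_fun_integral_kernel _ _ _ _ _ (fun t => a t : {measure set T -> \bar R})).
Qed.

Lemma kernel_feasible : feasible nu0 nu1 a.
Proof.
move=> B mB; rewrite aE//.
transitivity (\int[mu]_t (\1_B t)%:E); last by [].
by rewrite integral_indic// setIT.
Qed.

(** Walras law: averaging the bundles returns [mu], so total cost equals total income. If no bundle
    costs less than its owner's income, almost none costs more. *)
Lemma kernel_pairing_eq (p : T -> R) : bounded_measurable p -> (forall t, (0 <= p t)%R) ->
  {ae mu, forall t, (p t)%:E <= pairing p (a t)} ->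
  {ae mu, forall t, pairing p (a t) = (p t)%:E}.
Proof.
move=> [mp [M pM]] p0 pa.
have mEp : measurable_fun setT (EFin \o p) by exact/measurable_EFinP.
have M0 : (0 <= M)%R by apply: le_trans (pM (inl point)).
have pfin t : pairing p (a t) \is a fin_num.
  rewrite ge0_fin_numE; last by apply: integral_ge0 => s _; rewrite lee_fin.
  apply: (@le_lt_trans _ _ (\int[a t]_s (cst M%:E s))).
    apply: ge0_le_integral => //.
    - by move=> s _; rewrite lee_fin.
    - by move=> s _; rewrite lee_fin; apply: le_trans (pM s); exact: ler_norm.
  by rewrite integral_cst// lte_mul_pinfty// ltey_eq fin_num_measure.
pose g t := fine (pairing p (a t)).
have gE t : (g t)%:E = pairing p (a t) by rewrite fineK.
have mpa : measurable_fun setT (fun t => pairing p (a t)).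
  by apply: measurable_integral_a => // t; rewrite lee_fin.
have mg : measurable_fun setT g by apply: (measurableT_comp _ mpa).
have pg : \int[mu]_t (p t)%:E = \int[mu]_t (g t)%:E.
  by rewrite integral_a//; apply: eq_integral => t _; rewrite gE.
have : {ae mu, forall t, p t = g t}.
  apply: ae_eq_of_eq_integral => //.
  - by move=> t; apply: fine_ge0; apply: integral_ge0 => s _; rewrite lee_fin.
  - rewrite -pg; apply: (@le_lt_trans _ _ (\int[mu]_t (cst M%:E t))).
      apply: ge0_le_integral => //.
      + by move=> s _; rewrite lee_fin.
      + by move=> s _; rewrite lee_fin; apply: le_trans (pM s); exact: ler_norm.
    by rewrite integral_cst// lte_mul_pinfty// ltey_eq fin_num_measure.
  - by apply: filterS pa => t; rewrite -gE lee_fin.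
by apply: filterS => t pg_t; rewrite pg_t gE.
Qed.

Lemma kernel_allocation E : {ae mu, forall t, consumption E t (a t)} ->
  allocation E nu0 nu1 a.
Proof.
move=> ac.
have pairing_int q : bounded_measurable q ->
    mu.-integrable setT (fun t => pairing q (a t)) /\
    \int[mu]_t pairing q (a t) = \int[mu]_t (q t)%:E.
  move=> [mq [M qM]]; pose f := EFin \o q.
  have mf : measurable_fun setT f by exact/measurable_EFinP.
  have mfp : measurable_fun setT f^\+ by exact: measurable_funepos.
  have mfn : measurable_fun setT f^\- by exact: measurable_funeneg.
  have fint : mu.-integrable setT f.
    apply: measurable_bounded_integrable => //.
      by rewrite ltey_eq fin_num_measure.
    exists M; split; first exact: num_real.
    by move=> x Mx t _; apply: le_trans (qM t) _; exact: ltW.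
  (* The mixture identity concerns nonnegative functions, so it is applied to the positive and
     negative parts of [q]. *)
  have part (h : T -> \bar R) : (forall t, 0 <= h t) -> measurable_fun setT h ->
      \int[mu]_t h t < +oo -> mu.-integrable setT (fun t => \int[a t]_s h s).
    move=> h0 mh hoo; apply/integrableP; split; first exact: measurable_integral_a.
    under eq_integral do rewrite gee0_abs ?integral_ge0//.
    by rewrite -integral_a.
  have ip : mu.-integrable setT (fun t => \int[a t]_s f^\+ s).
    by apply: part => //; exact: integral_funepos_lt_pinfty.
  have in_ : mu.-integrable setT (fun t => \int[a t]_s f^\- s).
    by apply: part => //; exact: integral_funeneg_lt_pinfty.
  have -> : (fun t => pairing q (a t)) =
      (fun t => \int[a t]_s f^\+ s) \- (fun t => \int[a t]_s f^\- s).
    by apply/funext => t; rewrite /pairing integralE.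
  split; first exact: integrableB.
  rewrite integralB// -!integral_a//.
  by rewrite [RHS]integralE.
split => //.
- move=> q /pairing_int [iq _]; exists (fun t => pairing q (a t)); split => //.
  exact: aeW.
- exists (charge_of_finite_measure mu) => q /pairing_int [_ ->].
  exact: signed_integral_measure.
Qed.

End measure_preserving_kernel.

(** The induced allocation has this shape on each side: an exchange kernel on [S], the agent's own
    point mass elsewhere. *)
Lemma integral_piecewise_indic d (T : measurableType d) (R : realType)
    (nu : {measure set T -> \bar R}) (S B : set T) (f k : T -> \bar R) :
  measurable S -> measurable B -> measurable_fun setT k -> (forall x, 0 <= k x) ->
  (forall x, S x -> f x = k x) -> (forall x, ~ S x -> f x = (\1_B x)%:E) ->
  measurable_fun setT f /\ \int[nu]_x f x = \int[nu]_(x in S) k x + nu (B `\` S).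
Proof.
move=> mS mB mk k0 fS fN.
have mSC : measurable (~` S) by exact: measurableC.
have mi : measurable_fun setT (fun x => (\1_B x)%:E : \bar R).
  exact/measurable_EFinP/measurable_indic.
have -> : f = (k \_ S) \+ ((fun x => (\1_B x)%:E) \_ (~` S)).
  apply/funext => x; rewrite !patchE; have [Sx|nSx] := pselect (S x).
    by rewrite mem_set// memNset ?adde0 ?fS//; exact.
  by rewrite memNset// mem_set// add0e fN.
have mkS : measurable_fun setT (k \_ S).
  by apply/(measurable_restrictT _ mS); exact: measurable_funTS.
have miS : measurable_fun setT ((fun x => (\1_B x)%:E : \bar R) \_ (~` S)).
  by apply/(measurable_restrictT _ mSC); exact: measurable_funTS.
split; first exact: emeasurable_funD.
rewrite ge0_integralD//.
- by rewrite -!integral_mkcond integral_indic// setDE.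
- by move=> x _; rewrite patchE; case: ifPn.
- by move=> x _; rewrite patchE; case: ifPn => _; rewrite ?lee_fin.
Qed.

(** * The induced pair is an equilibrium *)

Section induced.
Context d0 d1 (T0 : measurableType d0) (T1 : measurableType d1) (R : realType).
Variables (E : set (T0 * T1)) (nu0 : {finite_measure set T0 -> \bar R})
  (nu1 : {finite_measure set T1 -> \bar R}).
Variables (F : nat -> set T0) (G : nat -> set T1).
Hypotheses (mF : forall i, measurable (F i)) (mG : forall i, measurable (G i)).
Hypothesis EC : forall x y, ~ E (x, y) <-> exists i, F i x /\ G i y.
Hypotheses (mT0 : forall x : T0, measurable [set x]) (mT1 : forall y : T1, measurable [set y]).
Hypothesis N1_neq0 : forall x, N1 E x !=set0.

Local Notation T := (T0 + T1)%type.
Local Notation bundle := {finite_measure set T -> \bar R}.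
Local Notation mu := (oplus nu0 nu1).

Let EC' (y : T1) (x : T0) : ~ N0 E y x <-> exists i, G i y /\ F i x.
Proof. by rewrite /N0 /= EC; split=> -[i []]; exists i. Qed.

Let edge1 (z : T0 * T1) : E z <-> N1 E z.1 z.2.
Proof. by case: z. Qed.

Let edge0 (z : T0 * T1) : E z <-> N0 E z.2 z.1.
Proof. by case: z. Qed.

Let mN1 := measurable_N1 mG EC.
Let mN0 := measurable_N0 mF EC.

(* The prices support the choice of agent [t]: a utility above [r] costs more
   than [c * r], the income of [t]. *)
Definition supported (a : T -> bundle) (p : T -> R) (t : T) : Prop :=
  exists c r : R, [/\ (0 < c)%R, p t = (c * r)%R, a t (neighbor E t) = r%:E &
    forall t', neighbor E t t' -> (c <= p t')%R].

Let measurable_neighbor t : measurable (neighbor E t).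
Proof. by case: t => [x|y]; [exact: measurable_image_inr|exact: measurable_image_inl]. Qed.

(** The bound [c] serves twice: it shows that [a t] costs at least the income, hence exactly the
    income by Walras law, and that every bundle of higher utility is too expensive. *)
Lemma supported_walrasian (a : T -> bundle) (p : T -> R) :
  bounded_measurable p -> (forall t, (0 <= p t)%R) -> (exists t, p t <> 0%R) ->
  (forall B, measurable B -> measurable_fun setT (fun t => a t B)) ->
  (forall B, measurable B -> \int[mu]_t a t B = mu B) ->
  {ae mu, forall t, consumption E t (a t)} ->
  {ae mu, forall t, supported a p t} ->
  walrasian_equilibrium E nu0 nu1 a p.
Proof.
move=> bp p0 pN0 ma aE ac sup; have [mp _] := bp.
split => //; first by split; [exact: kernel_allocation|exact: kernel_feasible].
have bound t (z : bundle) (c : R) : (0 <= c)%R ->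
    (forall t', neighbor E t t' -> (c <= p t')%R) ->
    c%:E * z (neighbor E t) <= pairing p z.
  by move=> c0 cp; apply: pairing_ge.
have pa : {ae mu, forall t, pairing p (a t) = (p t)%:E}.
  apply: kernel_pairing_eq => //; apply: filterS sup => t [c [r [c0 -> ar cp]]].
  by rewrite EFinM -ar; apply: bound => //; exact: ltW.
have pe t : pairing p (endowment R t) = (p t)%:E.
  by rewrite /pairing /endowment integral_dirac ?diracT ?mul1e//; exact/measurable_EFinP.
apply: filterS (filterI ac (filterI pa sup)) => t [act [pat [c [r [c0 pt ar cp]]]]].
split; first by split => //; rewrite pat pe.
move=> [z [[_ zp]]]; rewrite !utilityE ar => rz.
have := le_trans (bound t z c (ltW c0) cp) zp.
rewrite pe pt EFinM lee_pmul2l// => zr.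
by have := lt_le_trans rz zr; rewrite ltxx.
Qed.

Variables (pi0 pi1 : {finite_measure set (T0 * T1)%type -> \bar R}).

Lemma induced_walrasian (a : T -> bundle) (p : T -> R) :
  refinement E fst nu0 pi0 -> refinement E snd nu1 pi1 ->
  induced_pair E nu0 nu1 pi0 pi1 a p -> walrasian_equilibrium E nu0 nu1 a p.
Proof.
move=> [pi0E _] [pi1E _] [D0 [D1 [M0 [M1 [K0 [K1 [exc]]]]]]].
move=> [G0 [G1 [pi0ac [pi1ac [[pi0G pi1G] pi0acG pi1acG pi0acK pi1acK]]]]] ia [ip0 ip1].
have [[mM0 M00] [mM1 M10] [acM1 perpM1] [acM0 perpM0]] := exc.
have [mr0 r0 _] := dd_rho_density D0.
have [mr1 r1 _] := dd_rho_density D1.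
have mS0 := dd_Sac_measurable D0; have mS1 := dd_Sac_measurable D1.
have mP0 := dd_Sperp_measurable D0; have mP1 := dd_Sperp_measurable D1.
have perp0 y x : dd_Sperp D1 y -> N1 E x y -> M0 x by move=> Sy xy; apply: perpM0; exists y.
have perp1 x y : dd_Sperp D0 x -> N0 E y x -> M1 y by move=> Sx xy; apply: perpM1; exists x.
(* [K1] reverses the active part of [pi1], which starts on side 1; so side 0 takes the role of [S]
   here and side 1 that of [U]. *)
have K1N := exchange_neighborhood measurable_fst measurable_snd edge1 mF mG (fun x y => EC x y)
  pi1E pi1G pi1acG pi1acK.
have K0N := exchange_neighborhood measurable_snd measurable_fst edge0 mG mF EC'
  pi0E pi0G pi0acG pi0acK.
have K1r := exchange_mass measurable_fst measurable_snd edge1 mF mG (fun x y => EC x y)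
  pi1E pi1G pi1acG pi1acK mM0 M00 perp0.
have K0r := exchange_mass measurable_snd measurable_fst edge0 mG mF EC'
  pi0E pi0G pi0acG pi0acK mM1 M10 perp1.
have K1m B : measurable B -> \int[nu0]_(x in dd_Sac D0) K1 x B = nu1 (B `&` dd_Sac D1).
  exact: (exchange_marginal pi1acG pi1acK).
have K0m B : measurable B -> \int[nu1]_(y in dd_Sac D1) K0 y B = nu0 (B `&` dd_Sac D0).
  exact: (exchange_marginal pi0acG pi0acK).
have disj0 x : dd_Sac D0 x -> ~ dd_Sperp D0 x.
  by move=> Sx Px; have : (dd_Sac D0 `&` dd_Sperp D0) x by []; rewrite dd_disjoint.
have disj1 x : dd_Sac D1 x -> ~ dd_Sperp D1 x.
  by move=> Sx Px; have : (dd_Sac D1 `&` dd_Sperp D1) x by []; rewrite dd_disjoint.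
have aS0 x B : measurable B -> dd_Sac D0 x -> a (inl x) B = K1 x (inr @^-1` B).
  by move=> mB Sx; have [/(_ x)[-> // _ _] _] := ia B mB; rewrite /oplus add0e.
have aS1 y B : measurable B -> dd_Sac D1 y -> a (inr y) B = K0 y (inl @^-1` B).
  by move=> mB Sy; have [_ /(_ y)[-> // _ _]] := ia B mB; rewrite /oplus adde0.
(* Off [dd_Sac] every agent keeps its endowment, whether it lies in [dd_Sperp] or in neither set. *)
have aN0 x B : measurable B -> ~ dd_Sac D0 x -> a (inl x) B = (\1_(inl @^-1` B) x)%:E.
  move=> mB nSx; have [/(_ x)[_ aP aR] _] := ia B mB.
  have [Px|nPx] := pselect (dd_Sperp D0 x); first by rewrite aP// /oplus adde0.
  by rewrite aR//; case.
have aN1 y B : measurable B -> ~ dd_Sac D1 y -> a (inr y) B = (\1_(inr @^-1` B) y)%:E.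
  move=> mB nSy; have [_ /(_ y)[_ aP aR]] := ia B mB.
  have [Py|nPy] := pselect (dd_Sperp D1 y); first by rewrite aP// /oplus add0e.
  by rewrite aR//; case.
have pieces0 B : measurable B -> measurable_fun setT (fun x => a (inl x) B) /\
    \int[nu0]_x a (inl x) B = nu1 (inr @^-1` B `&` dd_Sac D1) + nu0 (inl @^-1` B `\` dd_Sac D0).
  move=> mB; have [mB0 mB1] := mB; rewrite -K1m//.
  apply: integral_piecewise_indic => //; first exact: measurable_kernel.
  - by move=> x; exact: aS0.
  - by move=> x; exact: aN0.
have pieces1 B : measurable B -> measurable_fun setT (fun y => a (inr y) B) /\
    \int[nu1]_y a (inr y) B = nu0 (inl @^-1` B `&` dd_Sac D0) + nu1 (inr @^-1` B `\` dd_Sac D1).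
  move=> mB; have [mB0 mB1] := mB; rewrite -K0m//.
  apply: integral_piecewise_indic => //; first exact: measurable_kernel.
  - by move=> y; exact: aS1.
  - by move=> y; exact: aN1.
have ma B : measurable B -> measurable_fun setT (fun t => a t B).
  by move=> mB; apply: measurable_fun_sumtype; [exact: (pieces0 B mB).1|exact: (pieces1 B mB).1].
have aE B : measurable B -> \int[mu]_t a t B = mu B.
  move=> mB; have [mB0 mB1] := mB.
  rewrite ge0_integral_oplus//; last exact: ma.
  (* On each side [dd_Sac] is bought by the other side and the rest is kept; regrouping by side
     restores [nu0] and [nu1]. *)
  rewrite (pieces0 B mB).2 (pieces1 B mB).2 addeACA [X in X + _]addeC addeACA.
  rewrite /oplus; congr (_ + _).
  - by rewrite addeC [RHS](measureDI nu0 mB0 mS0).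
  - by rewrite addeC [RHS](measureDI nu1 mB1 mS1).
have [mp0 p02] := measurable_induced_price mS0 mP0 mM0 mr0 r0 ip0.
have [mp1 p12] := measurable_induced_price mS1 mP1 mM1 mr1 r1 ip1.
have p0 t : (0 <= p t)%R.
  by case: t => t; [have /andP[] := p02 t|have /andP[] := p12 t].
have bp : bounded_measurable p.
  split; first exact: measurable_fun_sumtype.
  exists 2%R => t; rewrite ger0_norm//.
  by case: t => t; [have /andP[] := p02 t|have /andP[] := p12 t].
have price0 x r : ~ M0 x ->
    (dd_Sac D0 x /\ r = dd_rho D0 x) \/ (dd_Sperp D0 x /\ r = 0%R) ->
    exists c : R, [/\ (0 < c)%R, p (inl x) = (c * r)%R &
      forall y, N1 E x y -> (c <= p (inr y))%R].
  apply: (@supporting_price _ _ _ (N1 E) (dd_Sac D0) (dd_Sperp D0) M0 (dd_rho D0) (p \o inl)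
    (dd_Sac D1) (dd_Sperp D1) M1 (dd_rho D1) (p \o inr) r0 r1).
  - by move=> s; have [] := ip0 s.
  - by move=> s; have [] := ip0 s.
  - by move=> s; have [] := ip1 s.
  - by move=> s; have [] := ip1 s.
  - by move=> s u su Ss lt1; apply: acM1; exists s.
  - by move=> s u su Ss; apply: perpM1; exists s.
  - by move=> s u su Su; exact: perp0 Su su.
have price1 y r : ~ M1 y ->
    (dd_Sac D1 y /\ r = dd_rho D1 y) \/ (dd_Sperp D1 y /\ r = 0%R) ->
    exists c : R, [/\ (0 < c)%R, p (inr y) = (c * r)%R &
      forall x, N0 E y x -> (c <= p (inl x))%R].
  apply: (@supporting_price _ _ _ (N0 E) (dd_Sac D1) (dd_Sperp D1) M1 (dd_rho D1) (p \o inr)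
    (dd_Sac D0) (dd_Sperp D0) M0 (dd_rho D0) (p \o inl) r1 r0).
  - by move=> s; have [] := ip1 s.
  - by move=> s; have [] := ip1 s.
  - by move=> s; have [] := ip0 s.
  - by move=> s; have [] := ip0 s.
  - by move=> s u su Ss lt1; apply: acM0; exists s.
  - by move=> s u su Ss; apply: perpM0; exists s.
  - by move=> s u su Su; exact: perp1 Su su.
have pN0 : exists t, p t <> 0%R.
  (* Any point will do: its price is 2, or its supporting bound [c > 0] makes the price of some
     neighbor positive. *)
  pose x : T0 := point; have [p2 _ _] := ip0 x.
  have two : (2 : R)%R <> 0%R by apply/eqP; rewrite pnatr_eq0.
  have [bad|] := pselect (M0 x \/ ~ (dd_Sac D0 x \/ dd_Sperp D0 x)).
    by exists (inl x); rewrite p2.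
  move=> /not_orP[nM0 /contrapT Sx]; have [y xy] := N1_neq0 x.
  have [r rx] : exists r, (dd_Sac D0 x /\ r = dd_rho D0 x) \/ (dd_Sperp D0 x /\ r = 0%R).
    by case: Sx => Sx; [exists (dd_rho D0 x); left|exists 0%R; right].
  have [c [c0 _ /(_ _ xy) cy]] := price0 x r nM0 rx.
  by exists (inr y) => py0; move: cy; rewrite py0 leNgt c0.
have off0 : {ae nu0, forall x, ~ M0 x} by exists M0; split => // x /= /contrapT.
have off1 : {ae nu1, forall y, ~ M1 y} by exists M1; split => // y /= /contrapT.
have full d d' (X : measurableType d) (Y : measurableType d') (K : R.-ftker X ~> Y) x (C : set Y) :
    measurable C -> K x (~` C) = 0 -> K x C = K x setT.
  move=> mC KC; rewrite -(setUCr C) measureU ?setICr//; last exact: measurableC.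
  by rewrite [X in _ + X]KC adde0.
apply: supported_walrasian => //.
- apply/ae_oplus; split.
  + apply: filterS K1N => x K1x; split.
      have mC : measurable (@inl T0 T1 @` (~` [set x])).
        by apply: measurable_image_inl; exact: measurableC.
      have [Sx|nSx] := pselect (dd_Sac D0 x).
        by rewrite aS0// preimage_inr_inl measure0.
      by rewrite aN0// preimage_inl_inl indicE memNset//; exact.
    have mC : measurable (@inr T0 T1 @` (~` N1 E x)).
      by apply: measurable_image_inr; exact: measurableC.
    have [Sx|nSx] := pselect (dd_Sac D0 x).
      by rewrite aS0// preimage_inr_inr K1x.
    by rewrite aN0// preimage_inl_inr indic0.
  + apply: filterS K0N => y K0y; split.
      have mC : measurable (@inr T0 T1 @` (~` [set y])).
        by apply: measurable_image_inr; exact: measurableC.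
      have [Sy|nSy] := pselect (dd_Sac D1 y).
        by rewrite aS1// preimage_inl_inr measure0.
      by rewrite aN1// preimage_inr_inr indicE memNset//; exact.
    have mC : measurable (@inl T0 T1 @` (~` N0 E y)).
      by apply: measurable_image_inl; exact: measurableC.
    have [Sy|nSy] := pselect (dd_Sac D1 y).
      by rewrite aS1// preimage_inl_inl K0y.
    by rewrite aN1// preimage_inr_inl indic0.
- apply/ae_oplus; split.
  + apply: filterS (filterI off0 (filterI K1N (filterI K1r (dd_cover D0)))).
    move=> x [nM0 [K1x [K1rx cov]]].
    have mC : measurable (@inr T0 T1 @` N1 E x) by exact: measurable_image_inr.
    case: cov => Sx.
      have [c [c0 pc cp]] := price0 x (dd_rho D0 x) nM0 (or_introl (conj Sx erefl)).
      exists c, (dd_rho D0 x); split => //.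
        by rewrite /= aS0// preimage_inr_inr full// ?K1rx//; exact: K1x.
      by move=> _ [y xy <-]; exact: cp.
    have [c [c0 pc cp]] := price0 x 0%R nM0 (or_intror (conj Sx erefl)).
    exists c, 0%R; split => //.
      rewrite /= aN0//; last by move=> /disj0.
      by rewrite preimage_inl_inr indic0.
    by move=> _ [y xy <-]; exact: cp.
  + apply: filterS (filterI off1 (filterI K0N (filterI K0r (dd_cover D1)))).
    move=> y [nM1 [K0y [K0ry cov]]].
    have mC : measurable (@inl T0 T1 @` N0 E y) by exact: measurable_image_inl.
    case: cov => Sy.
      have [c [c0 pc cp]] := price1 y (dd_rho D1 y) nM1 (or_introl (conj Sy erefl)).
      exists c, (dd_rho D1 y); split => //.
        by rewrite /= aS1// preimage_inl_inl full// ?K0ry//; exact: K0y.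
      by move=> _ [x xy <-]; exact: cp.
    have [c [c0 pc cp]] := price1 y 0%R nM1 (or_intror (conj Sy erefl)).
    exists c, 0%R; split => //.
      rewrite /= aN1//; last by move=> /disj1.
      by rewrite preimage_inr_inl indic0.
    by move=> _ [x xy <-]; exact: cp.
Qed.

End induced.

(** * Closed relations on Polish spaces *)

Section polish_base.
Context (R : realType) (T : completePseudoMetricType R).

(** The base consists of the interiors of balls with centers in a dense sequence and radii
    [1 / (m + 1)]. *)
Lemma polish_countable_base : polish T -> exists B : nat -> set T,
  (forall i, open (B i)) /\
  forall x A, nbhs x A -> exists i, B i x /\ B i `<=` A.
Proof.
move=> [_ [D [/countable_injP[g ginj] dD]]].
have [f fD] : exists f : nat -> T, forall d, D d -> exists n, f n = d.
  have h n : exists d, (exists2 d', D d' & g d' = n) -> D d /\ g d = n.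
    have [[d Dd dn]|nd] := pselect (exists2 d', D d' & g d' = n); first by exists d.
    (* Default center for an index that codes no element of [D]. *)
    by exists point.
  exists (fun n => sval (cid (h n))) => d Dd; exists (g d).
  case: cid => d' /= []; first by exists d.
  by move=> Dd' gd'; apply: ginj => //; rewrite inE.
exists (fun k => if unpickle k is Some (n, m) then (ball (f n) (m.+1%:R^-1)%R)° else set0).
split; first by move=> k; case: unpickle => [[n m]|]; [exact: open_interior|exact: open0].
move=> x A /nbhs_ballP[e /= e0 xeA].
have [m me] : exists m : nat, (m.+1%:R^-1 < e / 2 :> R)%R.
  exists (Num.truncn (e / 2)^-1)%R; rewrite invf_plt ?posrE//; last by rewrite divr_gt0.
  exact: truncnS_gt.
pose r : R := (m.+1%:R^-1)%R; have r0 : (0 < r)%R by rewrite invr_gt0.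
have [d [xd Dd]] : (ball x (r / 2)%R)° `&` D !=set0.
  apply: dD; last exact: open_interior.
  by exists x; apply: nbhsx_ballx; rewrite divr_gt0.
have [n fn] := fD d Dd; exists (pickle (n, m)); rewrite pickleK fn.
have {}xd : ball x (r / 2)%R d by exact: interior_subset xd.
split.
  apply/nbhs_ballP; exists (r / 2)%R => /=; first by rewrite divr_gt0.
  by move=> y xy; apply: (ball_splitr xd).
move=> y /interior_subset dy; apply: xeA.
apply: (@le_ball _ _ _ (r / 2 + r)%R).
  by have := me; rewrite -/r; lra.
exact: ball_triangle xd dy.
Qed.

Lemma borel_measurable_open (A : set T) : open A -> measurable (A : set (borel T)).
Proof. by move=> oA; exact: sub_sigma_algebra. Qed.

Lemma polish_measurable_set1 (x : T) : polish T -> measurable ([set x] : set (borel T)).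
Proof.
move=> [hT _]; rewrite -(setCK [set x]); apply: measurableC.
apply: borel_measurable_open; rewrite openC.
exact/accessible_closed_set1/hausdorff_accessible.
Qed.

End polish_base.

(** The complement of [E] is open, hence the union of the basic rectangles it contains, and pairs of
    base indices are countable. *)
Lemma closed_polish_rectangles (R : realType) (T0 T1 : completePseudoMetricType R)
    (E : set (T0 * T1)) : polish T0 -> polish T1 -> closed E ->
  exists (F : nat -> set T0) (G : nat -> set T1),
    [/\ forall i, open (F i), forall i, open (G i) &
        forall x y, ~ E (x, y) <-> exists i, F i x /\ G i y].
Proof.
move=> /polish_countable_base[B0 [oB0 base0]] /polish_countable_base[B1 [oB1 base1]] cE.
(* At most one pair is good for [k], so the unions below are a single basic set, or empty when [k]
   codes no admissible rectangle. *)
pose good k (ij : nat * nat) := unpickle k = Some ij /\ B0 ij.1 `*` B1 ij.2 `<=` ~` E.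
exists (fun k => \bigcup_(ij in good k) B0 ij.1), (fun k => \bigcup_(ij in good k) B1 ij.2).
split.
- by move=> k; apply: bigcup_open => ij _; exact: oB0.
- by move=> k; apply: bigcup_open => ij _; exact: oB1.
- move=> x y; split=> [nE|[k [[ij [kij sub] B0x] [ij' [kij' _] B1y]]]]; last first.
    move: kij'; rewrite kij => -[ijE]; rewrite -ijE in B1y.
    exact: (sub (x, y)).
  have : nbhs (x, y) (~` E) by apply: open_nbhs_nbhs; split => //; exact: closed_openC.
  move=> [[P Q] /= [Px Qy] PQ].
  have [i [B0x B0P]] := base0 x P Px; have [j [B1y B1Q]] := base1 y Q Qy.
  have gij : good (pickle (i, j)) (i, j).
    by split; [rewrite pickleK|move=> [u v] /= [/B0P Pu /B1Q Qv]; exact: PQ].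
  by exists (pickle (i, j)); split; exists (i, j).
Qed.

Theorem theorem1p2 (R : realType) (Omega0 Omega1 : completePseudoMetricType R)
    (polish0 : polish Omega0) (polish1 : polish Omega1)
    (E : set (borel Omega0 * borel Omega1))
    (closedE : closed (E : set (Omega0 * Omega1)))
    (N1_neq0 : forall x : Omega0, N1 E x !=set0)
    (N0_neq0 : forall y : Omega1, N0 E y !=set0)
    (nu0 : {finite_measure set (borel Omega0) -> \bar R})
    (nu1 : {finite_measure set (borel Omega1) -> \bar R})
    (nu0_neq0 : nu0 setT <> 0) (nu1_neq0 : nu1 setT <> 0) :
  (forall pi0 pi1 : {finite_measure set (borel Omega0 * borel Omega1)%type -> \bar R},
    refinement E fst nu0 pi0 -> refinement E snd nu1 pi1 ->
    level_optimal_maximin E fst snd nu0 nu1 pi0 ->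
    level_optimal_maximin E snd fst nu1 nu0 pi1 ->
    forall (a : borel Omega0 + borel Omega1 ->
              {finite_measure set (borel Omega0 + borel Omega1)%type -> \bar R})
           (p : borel Omega0 + borel Omega1 -> R),
      induced_pair E nu0 nu1 pi0 pi1 a p ->
      walrasian_equilibrium E nu0 nu1 a p) /\
  (forall (a : borel Omega0 + borel Omega1 ->
             {finite_measure set (borel Omega0 + borel Omega1)%type -> \bar R})
          (p : borel Omega0 + borel Omega1 -> R),
    walrasian_equilibrium E nu0 nu1 a p ->
    forall pi0 pi1 : {finite_measure set (borel Omega0 * borel Omega1)%type -> \bar R},
      extracted_pair E nu0 nu1 pi0 pi1 a ->
      [/\ refinement E fst nu0 pi0, refinement E snd nu1 pi1,
          level_optimal_maximin E fst snd nu0 nu1 pi0 &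
          level_optimal_maximin E snd fst nu1 nu0 pi1]).
Proof.
(* Closedness of [E] enters through this countable family, which expresses the non-edges by
   measurable rectangles. *)
have [F [G [oF oG EC]]] := closed_polish_rectangles polish0 polish1 closedE.
have mF i : measurable (F i : set (borel Omega0)) by exact: borel_measurable_open.
have mG i : measurable (G i : set (borel Omega1)) by exact: borel_measurable_open.
split.
- move=> pi0 pi1 ref0 ref1 _ _ a p; apply: (@induced_walrasian _ _ _ _ _ E nu0 nu1 F G) => //.
  + by move=> x; exact: polish_measurable_set1.
  + by move=> y; exact: polish_measurable_set1.
- move=> a p eq pi0 pi1; exact: (@extracted_level_optimal _ _ _ _ _ E nu0 nu1 F G _ _ _ a p).
Qed.
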